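(* Let $m>1$ and $n>1$ be integers, let $G_{mn}=\langle a,b;\ [a^m,b^n]=1\rangle$, let $\lambda,\mu$ (and, when $m=n$, also $\eta$) be the automorphisms of $G_{mn}$ determined by $$\lambda: a\mapsto a^{-1},\ b\mapsto b;\qquad \mu: a\mapsto a,\ b\mapsto b^{-1};\qquad \eta: a\mapsto b,\ b\mapsto a \ \ (\text{only if } m=n),$$ and let $\alpha$ and $\beta$ be the inner automorphisms of $G_{mn}$ generated by the elements $a$ and $b$ respectively. (i) If $m\neq n$, then the group $\operatorname{Aut} G_{mn}$ is generated by the automorphisms $\lambda,\mu,\alpha,\beta$ and is defined, in these generators, by the relations 1. $\lambda^2=\mu^2=1$; 2. $\lambda\mu=\mu\lambda$; 3. $\lambda^{-1}\alpha\lambda=\alpha^{-1}$; 4. $\lambda^{-1}\beta\lambda=\beta$; 5. $\mu^{-1}\alpha\mu=\alpha$; 6. $\mu^{-1}\beta\mu=\beta^{-1}$; 7. $\alpha^m\beta^n=\beta^n\alpha^m$. (ii) If $m=n$, then the group $\operatorname{Aut} G_{mn}$ is generated by the automorphisms $\lambda,\mu,\eta,\alpha,\beta$ and is defined, in these generators, by the relations 1–7 listed in (i) together with the additional relations 8. $\eta^2=1$; 9. $\eta^{-1}\lambda\eta=\mu$; 10. $\eta^{-1}\alpha\eta=\beta$.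
   Context: $\langle a,b;\ [a^m,b^n]=1\rangle$ denotes the group with generators $a,b$ and the single defining relation $[a^m,b^n]=1$, where $[x,y]=x^{-1}y^{-1}xy$ is the commutator. Automorphisms are written on the right of their arguments and composed from left to right ($g(\varphi\psi)=(g\varphi)\psi$). The inner automorphism generated by an element $x$ is $g\mapsto x^{-1}gx$. ''The group is defined by the relations'' means that these generators and relations give a presentation of the group. *)

(* Defs.v *)
From HB Require Import structures.
From mathcomp Require Import all_boot.
From mathcomp Require Import boolp.

Set Implicit Arguments.
Unset Strict Implicit.
Unset Printing Implicit Defensive.

Local Open Scope group_scope.
Local Open Scope quotient_scope.

(* Words in the symbols x and x^-1, for x in X; the letter (x, true) stands
   for x^-1.  Words are not freely reduced: they form a monoid with a formal
   inversion, and free cancellation is part of [consequence] below. *)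
Definition word (X : Type) : Type := seq (X * bool).

HB.instance Definition _ X := gen_eqMixin (word X).
HB.instance Definition _ X := gen_choiceMixin (word X).

Section WordStarMonoid.
Variable X : Type.
Implicit Types u v w : word X.

Definition word_inv u : word X := rev [seq (c.1, ~~ c.2) | c <- u].

Fact word_mulA : associative (@cat (X * bool) : word X -> word X -> word X).
Proof. exact: catA. Qed.

Fact word_mul1w : left_id ([::] : word X) (@cat (X * bool)).
Proof. by []. Qed.

Fact word_invK : involutive word_inv.
Proof.
move=> u; rewrite /word_inv map_rev revK -map_comp -[RHS]map_id.
by apply: eq_map => -[x e] /=; rewrite negbK.
Qed.

Fact word_invM : {morph word_inv : u v / u ++ v >-> v ++ u}.
Proof. by move=> u v; rewrite /word_inv map_cat rev_cat. Qed.

HB.instance Definition _ :=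
  isStarMonoid.Build (word X) word_mulA word_mul1w word_invK word_invM.

Definition letter (x : X) : word X := [:: (x, false)].

End WordStarMonoid.

(* A pair (l, r) in R encodes the relation l = r. [consequence R u v] is the
   congruence on words generated by R and free cancellation: u and v are
   equal in the free group on X modulo the normal closure of the l * r^-1. *)
Inductive consequence X (R : seq (word X * word X)) : word X -> word X -> Prop :=
| csq_refl u : consequence R u u
| csq_sym u v : consequence R u v -> consequence R v u
| csq_trans v u w : consequence R u v -> consequence R v w -> consequence R u w
| csq_mul u u' v v' :
    consequence R u u' -> consequence R v v' -> consequence R (u * v) (u' * v')
| csq_cancel (u : word X) : consequence R (u * u^-1) 1
| csq_rel l r : (l, r) \in R -> consequence R l r.

Definition csq_rel_bool X (R : seq (word X * word X)) : rel (word X) :=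
  fun u v => `[< consequence R u v >].

Fact csq_bool_refl X R : reflexive (@csq_rel_bool X R).
Proof. by move=> u; apply/asboolP; exact: csq_refl. Qed.

Fact csq_bool_sym X R : symmetric (@csq_rel_bool X R).
Proof. by move=> u v; apply/asboolP/asboolP; exact: csq_sym. Qed.

Fact csq_bool_trans X R : transitive (@csq_rel_bool X R).
Proof.
by move=> v u w /asboolP Huv /asboolP Hvw; apply/asboolP; exact: csq_trans Hvw.
Qed.

Canonical csq_equiv X R :=
  EquivRel (@csq_rel_bool X R) (@csq_bool_refl X R) (@csq_bool_sym X R)
    (@csq_bool_trans X R).

Definition presented X (R : seq (word X * word X)) := {eq_quot csq_equiv R}.

HB.instance Definition _ X R := Choice.on (@presented X R).
HB.instance Definition _ X R := EqQuotient.on (@presented X R).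

Section PresentedGroup.
Variables (X : Type) (R : seq (word X * word X)).
Implicit Types (u v w : word X) (x y z : presented R).

Definition word_class u : presented R := \pi u.

Definition word_repr x : word X := repr x.

Lemma word_reprK : cancel word_repr word_class.
Proof. exact: reprK. Qed.

Lemma word_class_eqP u v : word_class u = word_class v <-> consequence R u v.
Proof. by split=> [/eqmodP/asboolP|/asboolP H]; last exact/eqmodP. Qed.

Lemma csq_inv u v : consequence R u v -> consequence R u^-1 v^-1.
Proof.
move=> Huv; apply: (@csq_trans _ _ (u^-1 * (v * v^-1))).
  rewrite -[X in consequence _ X]mulg1.
  exact: csq_mul (csq_refl _ _) (csq_sym (csq_cancel _ _)).
rewrite mulgA -[X in consequence _ _ X]mul1g; apply: csq_mul (csq_refl _ _).
apply: (@csq_trans _ _ (u^-1 * u)).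
  exact: csq_mul (csq_refl _ _) (csq_sym Huv).
by rewrite -[X in _ * X]invgK; exact: csq_cancel.
Qed.

Definition pmul x y := word_class (word_repr x * word_repr y).
Definition pone := word_class 1.
Definition pinv x := word_class (word_repr x)^-1.

Lemma repr_csq u : consequence R (word_repr (word_class u)) u.
Proof. by apply/word_class_eqP; rewrite word_reprK. Qed.

Lemma pmulE u v : pmul (word_class u) (word_class v) = word_class (u * v).
Proof. by apply/word_class_eqP; apply: csq_mul; exact: repr_csq. Qed.

Lemma pinvE u : pinv (word_class u) = word_class u^-1.
Proof. by apply/word_class_eqP; apply: csq_inv; exact: repr_csq. Qed.

Fact pmulA : associative pmul.
Proof.
move=> x y z; rewrite -[x]word_reprK -[y]word_reprK -[z]word_reprK.
by rewrite !pmulE mulgA.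
Qed.

Fact pmul1x : left_id pone pmul.
Proof. by move=> x; rewrite -[x]word_reprK pmulE mul1g. Qed.

Fact pmulx1 : right_id pone pmul.
Proof. by move=> x; rewrite -[x]word_reprK pmulE mulg1. Qed.

Fact pmulxV : right_inverse pone pinv pmul.
Proof.
move=> x; rewrite -[x]word_reprK pinvE pmulE; apply/word_class_eqP.
exact: csq_cancel.
Qed.

Fact pmulVx : left_inverse pone pinv pmul.
Proof.
move=> x; rewrite -[x]word_reprK pinvE pmulE; apply/word_class_eqP.
by rewrite -[X in _ * X]invgK; exact: csq_cancel.
Qed.

HB.instance Definition _ :=
  isGroup.Build (presented R) pmulA pmul1x pmulx1 pmulVx pmulxV.

Definition pgen (x : X) : presented R := word_class (letter x).

End PresentedGroup.

Section Presentations.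
Variables (G : groupType) (X : Type) (g : X -> G).

Definition word_eval (w : word X) : G :=
  \prod_(c <- w) (if c.2 then (g c.1)^-1 else g c.1).

(* [defined_by R]: the words in the g x that coincide in G are exactly those
   identified by R, i.e. the kernel of evaluation on the free group on X is the
   normal closure of the relators; with [generated_by], <X; R> presents G. *)
Definition generated_by : Prop := forall x : G, exists w, word_eval w = x.

Definition defined_by (R : seq (word X * word X)) : Prop :=
  forall u v, word_eval u = word_eval v <-> consequence R u v.

Definition presented_by R : Prop := generated_by /\ defined_by R.

End Presentations.

Lemma presentedP X (R : seq (word X * word X)) : presented_by (@pgen X R) R.
Proof.
have ev w : word_eval (@pgen X R) w = word_class R w.
  rewrite /word_eval; elim: w => [|[x e] w IHw]; first by rewrite big_nil.
  rewrite big_cons IHw -[(x, e) :: w]/(([:: (x, e)] : word X) * w) -pmulE.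
  by case: e => //; congr (_ * _); exact: pinvE.
split=> [x|u v]; first by exists (word_repr x); rewrite ev word_reprK.
by rewrite !ev; exact: word_class_eqP.
Qed.

Record aut (G : groupType) : Type := Aut {
  aut_fun :> G -> G;
  aut_bij : bijective aut_fun;
  aut_morph : {morph aut_fun : x y / x * y}
}.

HB.instance Definition _ G := gen_eqMixin (aut G).
HB.instance Definition _ G := gen_choiceMixin (aut G).

Section AutGroup.
Variable G : groupType.
Implicit Types (f h k : aut G) (x y z : G).

Lemma autP f h : f =1 h -> f = h.
Proof.
case: f h => [f fb fm] [h hb hm] /= /funext fh; subst h.
by rewrite (Prop_irrelevance fb hb) (Prop_irrelevance fm hm).
Qed.

Fact aut_one_morph : {morph (id : G -> G) : x y / x * y}. Proof. by []. Qed.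
Definition aut_one : aut G := Aut (inv_bij (fun=> erefl)) aut_one_morph.

(* Automorphisms act on the right: f * h is f followed by h. *)
Fact aut_mul_morph f h : {morph (h \o f) : x y / x * y}.
Proof. by move=> x y /=; rewrite !aut_morph. Qed.
Definition aut_mul f h : aut G :=
  Aut (bij_comp (aut_bij h) (aut_bij f)) (aut_mul_morph f h).

Fact aut_inv_subproof f : {f' : G -> G | cancel f f' & cancel f' f}.
Proof.
suff /cid [f' [fK f'K]] : exists f' : G -> G, cancel f f' /\ cancel f' f by exists f'.
by have [f' fK f'K] := aut_bij f; exists f'.
Qed.
Definition aut_inv_fun f : G -> G := s2val (aut_inv_subproof f).
Fact aut_funK f : cancel f (aut_inv_fun f).
Proof. exact: (s2valP (aut_inv_subproof f)). Qed.
Fact aut_inv_funK f : cancel (aut_inv_fun f) f.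
Proof. exact: (s2valP' (aut_inv_subproof f)). Qed.
Fact aut_inv_morph f : {morph aut_inv_fun f : x y / x * y}.
Proof.
move=> x y; apply: (bij_inj (aut_bij f)).
by rewrite aut_morph !aut_inv_funK.
Qed.
Definition aut_inv f : aut G :=
  Aut (Bijective (aut_inv_funK f) (@aut_funK f)) (@aut_inv_morph f).

Fact aut_mulA : associative aut_mul. Proof. by move=> f h k; exact: autP. Qed.
Fact aut_mul1f : left_id aut_one aut_mul. Proof. by move=> f; exact: autP. Qed.
Fact aut_mulf1 : right_id aut_one aut_mul. Proof. by move=> f; exact: autP. Qed.
Fact aut_mulVf : left_inverse aut_one aut_inv aut_mul.
Proof. by move=> f; apply: autP; exact: aut_inv_funK. Qed.
Fact aut_mulfV : right_inverse aut_one aut_inv aut_mul.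
Proof. by move=> f; apply: autP; exact: aut_funK. Qed.

HB.instance Definition _ :=
  isGroup.Build (aut G) aut_mulA aut_mul1f aut_mulf1 aut_mulVf aut_mulfV.

Fact inner_bij x : bijective (fun g => x^-1 * g * x).
Proof.
by exists (fun g => x * g * x^-1) => g; rewrite !mulgA ?mulgV ?mulVg mul1g
  ?mulgK ?mulgVK.
Qed.
Fact inner_morph x : {morph (fun g => x^-1 * g * x) : y z / y * z}.
Proof. by move=> y z; rewrite !mulgA mulgK. Qed.
Definition inner x : aut G := Aut (inner_bij x) (@inner_morph x).

End AutGroup.

Variant gen_ab := Gen_a | Gen_b.

Definition Gmn_relations (m n : nat) : seq (word gen_ab * word gen_ab) :=
  let a := letter Gen_a in let b := letter Gen_b in
  [:: ([~ a ^+ m, b ^+ n], 1)].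

Definition Gmn (m n : nat) : groupType := presented (Gmn_relations m n).

Definition Gmn_a m n : Gmn m n := pgen _ Gen_a.
Definition Gmn_b m n : Gmn m n := pgen _ Gen_b.

Variant gen4 := Lambda4 | Mu4 | Alpha4 | Beta4.
Variant gen5 := Lambda5 | Mu5 | Eta5 | Alpha5 | Beta5.

Definition family4 T (lambda mu alpha beta : T) (x : gen4) : T :=
  match x with
  | Lambda4 => lambda | Mu4 => mu | Alpha4 => alpha | Beta4 => beta
  end.

Definition family5 T (lambda mu eta alpha beta : T) (x : gen5) : T :=
  match x with
  | Lambda5 => lambda | Mu5 => mu | Eta5 => eta
  | Alpha5 => alpha | Beta5 => beta
  end.

Definition common_relations X (m n : nat) (lambda mu alpha beta : word X) :
    seq (word X * word X) :=
  [:: (lambda ^+ 2, 1);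
      (mu ^+ 2, 1);
      (lambda * mu, mu * lambda);
      (lambda^-1 * alpha * lambda, alpha^-1);
      (lambda^-1 * beta * lambda, beta);
      (mu^-1 * alpha * mu, alpha);
      (mu^-1 * beta * mu, beta^-1);
      (alpha ^+ m * beta ^+ n, beta ^+ n * alpha ^+ m)].

Definition relations4 m n : seq (word gen4 * word gen4) :=
  common_relations m n
    (letter Lambda4) (letter Mu4) (letter Alpha4) (letter Beta4).

Definition relations5 m n : seq (word gen5 * word gen5) :=
  let lambda := letter Lambda5 in let mu := letter Mu5 in
  let eta := letter Eta5 in
  let alpha := letter Alpha5 in let beta := letter Beta5 in
  common_relations m n lambda mu alpha beta ++
  [:: (eta ^+ 2, 1);
      (eta^-1 * lambda * eta, mu);
      (eta^-1 * alpha * eta, beta)].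

(* Main.v *)
Require Import Defs.
From HB Require Import structures.
From mathcomp Require Import all_boot order ssralg ssrnum ssrint intdiv.
From mathcomp Require Import zify.
From mathcomp Require Import boolp.

Set Implicit Arguments.
Unset Strict Implicit.
Unset Printing Implicit Defensive.
Import GRing.Theory.

Local Open Scope group_scope.

(** Put x_true = a, x_false = b, N true = m, N false = n and c_s = x_s^(N s).
    The group G is obtained from the free abelian group H on c_true, c_false
    by adjoining an N s-th root x_s of c_s for each s.  So an element of G is,
    in a unique way, a reduced product of syllables c_(~s)^z x_s^i with
    0 < i < N s, followed by an element of H ([nfK], [evK]).  Uniqueness is
    proved by letting G act on the reduced sequences.  Cosets of H and of the
    cyclic groups generated by a and b are the vertices of a tree, two normal
    forms branch off where they first differ, and the number [len] of
    syllables is half a distance in this tree; all that is used of the tree is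
    the four-point inequality [len_4point].

    Generation.  Let phi be an automorphism.  In G the element b^n commutes
    with a^m but not with a, so phi(b^n) commutes with the power phi(a)^m but
    not with phi(a).  By [commute_power_cases] this forces phi(a) to be
    conjugate to a power of a or of b.  Indeed, elements translating the tree
    along an axis have unique roots up to H ([root_unique_len]), and an element
    of H is recognised by its exponent sums; elements fixing a vertex are dealt
    with by computing centralisers.  Since phi is onto, exponent sums show that
    phi(a), phi(b) are conjugates of a and b or their inverses, possibly
    exchanged, and an exchange needs m | n and n | m ([aut_gx_cases]).

    Up to lambda, mu, eta and inner automorphisms, phi fixes a and sends b to
    g^-1 b g, where a^m commutes with g^-1 b^n g.  Normal forms then give
    g = g1 g2 with g1 centralising b^n and g2 centralising a^m
    ([commute_conj_factor]).  In the quotient of G where n is replaced by 1, the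
    element g1 becomes a product of a power of b and a central element, and a
    ping-pong argument shows that a and a conjugate of b can only generate in
    the obvious way ([double_coset_of_surjective]); this determines g2.  By
    symmetry it determines g1, and g is a power of b times a power of a, so
    that phi is inner ([aut_fix_conj]).

    Relations.  In the group presented by the relations, the subgroup generated
    by alpha and beta is an image of G, because alpha^m and beta^n commute there,
    and it is normalised by the other generators; hence every element is t theta(y) with
    t in the finite set of products of powers of lambda, mu (and eta).  If it
    acts trivially on G, then exponent sums give t = 1, and y = 1 because G has
    trivial centre ([center_trivial]). *)

(** * Integer powers *)

Section IntegerPowers.
Variable G : groupType.
Implicit Types (x y t : G) (j k : int).

Definition zexp x k := match k with Posz n => x ^+ n | Negz n => x ^- n.+1 end.
Local Notation "x ^% k" := (zexp x k) (at level 29, left associativity).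

Lemma zexp0 x : x ^% 0%R = 1. Proof. by []. Qed.
Lemma zexp1 x : x ^% 1%R = x. Proof. by []. Qed.

Lemma zexpS x k : x ^% (k + 1)%R = x ^% k * x.
Proof.
case: k => [n|[|n]].
- have -> : (Posz n + 1)%R = n.+1 by lia.
  by rewrite /= expgSr.
- by rewrite (_ : (Negz 0 + 1)%R = 0%R) ?expg1 ?mulVg //; lia.
- have -> : (Negz n.+1 + 1)%R = Negz n by lia.
  by rewrite /= [in RHS]expgS invgM mulgVK.
Qed.

Lemma zexpD x j k : x ^% (j + k)%R = x ^% j * x ^% k.
Proof.
elim/int_rect: k => [|n IHn|n IHn].
- by rewrite mulg1; congr zexp; lia.
- have -> : (j + n.+1)%R = (j + Posz n + 1)%R by lia.
  have -> : Posz n.+1 = (Posz n + 1)%R by lia.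
  rewrite !zexpS IHn. by rewrite mulgA.
- apply: (@mulIg _ x); rewrite -mulgA -!zexpS.
  have -> : (j - Posz n.+1 + 1)%R = (j - Posz n)%R by lia.
  by have -> : (- Posz n.+1 + 1)%R = (- Posz n)%R by lia.
Qed.

Lemma zexpN x k : x ^% (- k)%R = (x ^% k)^-1.
Proof. by apply: (@mulIg _ (x ^% k)); rewrite mulVg -zexpD addNr. Qed.

Lemma zexpM x j k : x ^% (j * k)%R = x ^% j ^% k.
Proof.
elim/int_rect: k => [|n IHn|n IHn]; first by rewrite mulr0.
- have -> : (j * Posz n.+1)%R = (j * Posz n + j)%R by lia.
  have -> : Posz n.+1 = (Posz n + 1)%R by lia.
  by rewrite [LHS]zexpD [RHS]zexpS IHn.
- have -> : (j * - Posz n.+1)%R = (j * - Posz n - j)%R by lia.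
  have -> : (- Posz n.+1)%R = (- Posz n + - 1)%R by lia.
  by rewrite [LHS]zexpD [RHS]zexpD IHn !zexpN zexp1.
Qed.

Lemma commute_zexp x y k : commute x y -> commute x (y ^% k).
Proof.
by move=> cxy; case: k => n; [exact: commuteX | apply/commuteV/commuteX].
Qed.

Lemma commute_zexp2 x y j k : commute x y -> commute (x ^% j) (y ^% k).
Proof. by move=> cxy; apply/commute_zexp/commute_sym/commute_zexp. Qed.

Lemma zexpMg x y k : commute x y -> (x * y) ^% k = x ^% k * y ^% k.
Proof.
move=> cxy; case: k => n /=; rewrite expgMn // invgM.
by apply/commuteV/commute_sym/commuteV/commuteX2.
Qed.

End IntegerPowers.

Notation "x ^% k" := (zexp x k) (at level 29, left associativity) : group_scope.

Section Morphisms.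
Variables (G K : groupType) (f : G -> K).
Hypothesis fM : {morph f : x y / x * y}.

Lemma morph1 : f 1 = 1.
Proof. by apply: (@mulIg _ (f 1)); rewrite -fM !mul1g. Qed.

Lemma morphV : {morph f : x / x^-1}.
Proof. by move=> x; apply: (@mulIg _ (f x)); rewrite -fM !mulVg morph1. Qed.

Lemma morphX n : {morph f : x / x ^+ n}.
Proof.
by move=> x; elim: n => [|n IHn]; rewrite ?morph1 // !expgS fM IHn.
Qed.

Lemma morph_zexp k : {morph f : x / x ^% k}.
Proof. by move=> x; case: k => n; rewrite /= ?morphV morphX. Qed.

Lemma morphJ : {morph f : x y / x ^ y}.
Proof. by move=> x y; rewrite !conjgE !fM morphV. Qed.

Lemma morph_commute x y : commute x y -> commute (f x) (f y).
Proof. by move=> cxy; rewrite /commute -!fM cxy. Qed.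

End Morphisms.

Section Conjugation.
Variable G : groupType.
Implicit Types x y t : G.

Lemma conjg_zexp x t k : (x ^% k) ^ t = (x ^ t) ^% k.
Proof. exact: (morph_zexp (fun x y => conjMg x y t)). Qed.

Lemma commute_conj x y t : commute (x ^ t) (y ^ t) <-> commute x y.
Proof.
split=> [cxy|]; last exact: (morph_commute (fun x y => conjMg x y t)).
by apply: (@conjg_inj _ t); rewrite !conjMg.
Qed.

Lemma innerE x y : inner x y = y ^ x.
Proof. by rewrite conjgE mulgA. Qed.

Lemma innerM x y : inner (x * y) = inner x * inner y.
Proof. by apply: autP => z; rewrite innerE conjgM -!innerE. Qed.

Lemma inner1 : inner (1 : G) = 1.
Proof. by apply: autP => x; rewrite innerE conjg1. Qed.

Lemma innerV x : inner x^-1 = (inner x)^-1.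
Proof. by apply: (@mulIg _ (inner x)); rewrite mulVg -innerM mulVg inner1. Qed.

Lemma aut_mulE (f h : aut G) x : (f * h) x = h (f x). Proof. by []. Qed.

Lemma autVK (f : aut G) x : f (f^-1 x) = x.
Proof. by rewrite -aut_mulE mulVg. Qed.

Lemma innerJ (f : aut G) x : inner x ^ f = inner (f x).
Proof.
apply: autP => y; rewrite conjgE !aut_mulE !innerE !conjgE.
by rewrite !aut_morph (morphV (aut_morph f)) autVK.
Qed.

End Conjugation.

(** * Presented groups *)

Section WordEval.
Variables (G : groupType) (X : Type) (g : X -> G).
Implicit Types u v : word X.

Lemma word_evalM u v : word_eval g (u * v) = word_eval g u * word_eval g v.
Proof. by rewrite /word_eval big_cat. Qed.

Lemma word_eval1 : word_eval g 1 = 1.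
Proof. by rewrite /word_eval big_nil. Qed.

Lemma word_eval_nil : word_eval g [::] = 1. Proof. exact: word_eval1. Qed.

Lemma word_eval_cons x e u :
  word_eval g ((x, e) :: u) = (if e then (g x)^-1 else g x) * word_eval g u.
Proof. by rewrite /word_eval big_cons. Qed.

Lemma word_eval_letter x : word_eval g (letter x) = g x.
Proof. by rewrite word_eval_cons word_eval1 mulg1. Qed.

Lemma word_evalV u : word_eval g u^-1 = (word_eval g u)^-1.
Proof.
elim: u => [|[x e] u IHu].
  by rewrite -[[::]]/(1 : word X) -[1^-1]/(1 : word X) word_eval1 invg1.
rewrite -[(x, e) :: u]/(([:: (x, e)] : word X) * u) invgM !word_evalM IHu invgM.
congr (_ * _); rewrite (_ : ([:: (x, e)] : word X)^-1 = [:: (x, ~~ e)]) //.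
rewrite !word_eval_cons word_eval1.
by rewrite !mulg1; case: e; rewrite ?invgK.
Qed.

Lemma word_evalX u n : word_eval g (u ^+ n) = word_eval g u ^+ n.
Proof.
by elim: n => [|n IHn]; rewrite ?word_eval1 // !expgS word_evalM IHn.
Qed.

Definition word_evalE :=
  (word_evalM, word_evalV, word_evalX, word_eval1, word_eval_letter).

Variable R : seq (word X * word X).

Lemma word_eval_csq u v :
  (forall l r, (l, r) \in R -> word_eval g l = word_eval g r) ->
  consequence R u v -> word_eval g u = word_eval g v.
Proof.
move=> gR; elim=> {u v} //.
- by move=> u v w _ -> _ ->.
- by move=> u u' v v' _ IHu _ IHv; rewrite !word_evalM IHu IHv.
- by move=> u; rewrite !word_evalE mulgV.
Qed.

End WordEval.


Section UniversalProperty.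
Variables (X : Type) (R : seq (word X * word X)).
Implicit Types (u v : word X) (x y : presented R).

Lemma word_classM u v : word_class R (u * v) = word_class R u * word_class R v.
Proof. by rewrite -pmulE. Qed.

Lemma word_classV u : word_class R u^-1 = (word_class R u)^-1.
Proof. by rewrite -pinvE. Qed.

Lemma word_class1 : word_class R 1 = 1. Proof. by []. Qed.

Lemma word_eval_pgen u : word_eval (@pgen X R) u = word_class R u.
Proof.
elim: u => [|[x e] u IHu]; first by rewrite word_eval_nil.
rewrite word_eval_cons IHu -[(x, e) :: u]/(([:: (x, e)] : word X) * u) word_classM.
by congr (_ * _); case: e => //; rewrite /pgen -word_classV.
Qed.

Lemma presented_ind (P : presented R -> Prop) :
  P 1 -> (forall c y, P y -> P (pgen R c * y)) ->
  (forall c y, P y -> P ((pgen R c)^-1 * y)) -> forall y, P y.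
Proof.
move=> P1 Pg PV y; rewrite -[y]word_reprK -word_eval_pgen.
elim: (word_repr y) => [|[x e] u IHu]; first by rewrite word_eval_nil.
by rewrite word_eval_cons; case: e; [apply: PV | apply: Pg].
Qed.

Lemma presented_hom_ext (K : groupType) (f h : presented R -> K) :
  {morph f : x y / x * y} -> {morph h : x y / x * y} ->
  (forall c, f (pgen R c) = h (pgen R c)) -> f =1 h.
Proof.
move=> fM hM fh; apply: presented_ind => [|x y IHy|x y IHy].
- by rewrite (morph1 fM) (morph1 hM).
- by rewrite fM hM fh IHy.
- by rewrite fM hM (morphV fM) (morphV hM) fh IHy.
Qed.

Variables (K : groupType) (f : X -> K).

Definition presented_lift x : K := word_eval f (word_repr x).

Hypothesis fR : forall l r, (l, r) \in R -> word_eval f l = word_eval f r.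

Lemma presented_lift_class u : presented_lift (word_class R u) = word_eval f u.
Proof. exact: word_eval_csq (repr_csq _ _). Qed.

Lemma presented_liftM : {morph presented_lift : x y / x * y}.
Proof.
move=> x y; rewrite -[x]word_reprK -[y]word_reprK -word_classM !presented_lift_class.
by rewrite word_evalM.
Qed.

Lemma presented_lift_gen c : presented_lift (pgen R c) = f c.
Proof. by rewrite presented_lift_class word_eval_letter. Qed.

End UniversalProperty.

(** * Reduced sequences of syllables *)

(** The syllable (s, z, i) stands for c_(~s)^z x_s^i, and the pair (p, q) in a
    state for c_true^p c_false^q; true is the side of a. *)
Definition syllable : Type := bool * int * int.
Definition state : Type := seq syllable * (int * int).

Section Syllables.
Implicit Types (s t : bool) (j k z i r : int) (u v : seq syllable) (w : state).

(** The product coded by u begins with a nonzero power of x_s exactly when its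
    first syllable has side s and z = 0. *)
Definition starts s u :=
  if u is (s', z, _) :: _ then (s' == s) && (z == 0%R) else false.
Definition head_exp s u : int :=
  if u is (_, _, i) :: _ then if starts s u then i else 0%R else 0%R.
Definition strip s u := if starts s u then behead u else u.
(** Left multiplication by x_s^r for 0 <= r < N s, on sequences that do not
    start with a power of x_s; [head_exp] and [strip] undo it. *)
Definition glue s r u := if r == 0%R then u else (s, 0%R, r) :: u.

Definition on_side s u := all (fun l : syllable => l.1.1 == s) u.
Definition tail_exp s (h : int * int) := if s then h.1 else h.2.
Definition tail_add s k (h : int * int) :=
  if s then ((h.1 + k)%R, h.2) else (h.1, (h.2 + k)%R).

(** Left multiplication by c_s^k: the factor c_s^k commutes with the syllables
    of side s and is absorbed by the first syllable of the other side, or else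
    by the tail. *)
Fixpoint cshift s k u : seq syllable :=
  if u is (s', z, i) :: u' then
    if s' == s then (s', z, i) :: cshift s k u' else (s', (z + k)%R, i) :: u'
  else [::].

Definition cact s k w : state :=
  (cshift s k w.1, if on_side s w.1 then tail_add s k w.2 else w.2).

Lemma starts_glue s r u : ~~ starts s u -> starts s (glue s r u) = (r != 0%R).
Proof.
by rewrite /glue; case: eqP => [_ /negbTE->|_ _] //=; rewrite !eqxx.
Qed.

Lemma head_exp_nostart s u : ~~ starts s u -> head_exp s u = 0%R.
Proof. by case: u => [|[[s' z] i] u] //= /negbTE->. Qed.

Lemma head_glue s r u : ~~ starts s u -> head_exp s (glue s r u) = r.
Proof.
rewrite /glue; case: eqP => [-> /head_exp_nostart //|_ _] /=.
by rewrite !eqxx.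
Qed.

Lemma strip_glue s r u : ~~ starts s u -> strip s (glue s r u) = u.
Proof.
by move=> nu; rewrite /strip starts_glue // /glue; case: eqP.
Qed.

Lemma starts_cshift s k u : starts s (cshift s k u) = starts s u.
Proof. by case: u => [|[[s1 z] i] u] //=; case E: (s1 == s); rewrite /= ?E. Qed.

Lemma size_cshift s k u : size (cshift s k u) = size u.
Proof. by elim: u => [|[[s' z] i] u IHu] //=; case: eqP => //= _; rewrite IHu. Qed.

Lemma on_side_cshift s t k u : on_side s (cshift t k u) = on_side s u.
Proof. by elim: u => [|[[s' z] i] u IHu] //=; case: eqP => //= _; rewrite IHu. Qed.

Lemma cshift0 s u : cshift s 0%R u = u.
Proof.
by elim: u => [|[[s' z] i] u IHu] //=; case: eqP => _; rewrite ?IHu ?addr0.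
Qed.

Lemma cshiftD s j k u : cshift s (j + k)%R u = cshift s j (cshift s k u).
Proof.
elim: u => [|[[s' z] i] u IHu] //=; case: eqP => [->|/eqP/negbTE ns] /=.
  by rewrite eqxx IHu.
by rewrite ns addrAC addrA.
Qed.

Lemma cshiftC s t j k u : cshift s j (cshift t k u) = cshift t k (cshift s j u).
Proof.
elim: u => [|[[s' z] i] u IHu] //=.
case: (s' =P t) => [->|/eqP/negbTE nt] /=; case: eqP => [e|/eqP/negbTE ns] /=.
- by rewrite eqxx IHu.
- by rewrite eqxx.
- by rewrite nt.
- by rewrite nt addrAC.
Qed.

Lemma tail_addD s j k h : tail_add s (j + k)%R h = tail_add s j (tail_add s k h).
Proof. by case: s; rewrite /tail_add /= addrAC addrA. Qed.

Lemma tail_addC s t j k h :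
  tail_add s j (tail_add t k h) = tail_add t k (tail_add s j h).
Proof. by case: s; case: t; rewrite /tail_add //= addrAC. Qed.

Lemma tail_add0 s h : tail_add s 0%R h = h.
Proof. by case: s; case: h => p q; rewrite /tail_add /= addr0. Qed.

Lemma cactD s j k w : cact s (j + k)%R w = cact s j (cact s k w).
Proof.
rewrite /cact /= on_side_cshift cshiftD; congr pair.
by case: on_side; rewrite ?tail_addD.
Qed.

Lemma cactC s t j k w : cact s j (cact t k w) = cact t k (cact s j w).
Proof.
rewrite /cact /= !on_side_cshift cshiftC; congr pair.
by case: on_side; case: on_side; rewrite // tail_addC.
Qed.

End Syllables.

Section Reduced.
Variable N : bool -> nat.
Hypothesis N_gt0 : forall s, (0 < N s)%N.
Implicit Types (s t : bool) (j k z i r : int) (u v : seq syllable) (w : state).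

(** Between two neighbouring syllables of the same side s the power of c_(~s)
    must be nontrivial, since otherwise the two powers of x_s would merge. *)
Fixpoint reduced u : bool :=
  if u is (s, _, i) :: u' then
    [&& (0 < i)%R, (i < N s)%R, ~~ starts s u' & reduced u']
  else true.

(** Left multiplication by x_s^k: the leading power of x_s is x_s^(e + k), whose
    exponent is divided by N s; the quotient becomes a power of c_s. *)
Definition xact s k w : state :=
  let t := (head_exp s w.1 + k)%R in
  let w' := cact s (t %/ N s)%Z (strip s w.1, w.2) in
  (glue s (t %% N s)%Z w'.1, w'.2).

Lemma reduced_cshift s k u : reduced (cshift s k u) = reduced u.
Proof.
elim: u => [|[[s' z] i] u IHu] //=; case: eqP => [->|//] /=.
by rewrite IHu starts_cshift.
Qed.

Lemma reduced_cact s k w : reduced (cact s k w).1 = reduced w.1.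
Proof. exact: reduced_cshift. Qed.

Lemma reduced_strip s u : reduced u -> reduced (strip s u) && ~~ starts s (strip s u).
Proof.
rewrite /strip; case: ifP => [|/negbT su ->] //.
by case: u => [|[[s' z] i] u] //= /andP[/eqP-> _] /and4P[_ _ -> ->].
Qed.

Lemma head_exp_bound s u : reduced u -> (0 <= head_exp s u)%R && (head_exp s u < N s)%R.
Proof.
have N0 := N_gt0 s; case: u => [|[[s' z] i] u] /=; first by lia.
by move=> /and4P[]; case E: ((s' == s) && _); first move/andP: E => [/eqP-> _]; lia.
Qed.

Lemma glue_strip s u : reduced u -> glue s (head_exp s u) (strip s u) = u.
Proof.
rewrite /glue /strip; case: u => [|[[s' z] i] u] //= /and4P[i0 _ _ _].
case E: ((s' == s) && _) => //; move/andP: E i0 => [/eqP-> /eqP->].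
by case: eqP => // ->.
Qed.

Lemma reduced_glue s r u : (0 <= r)%R -> (r < N s)%R -> reduced u ->
  ~~ starts s u -> reduced (glue s r u).
Proof. by rewrite /glue; case: eqP => //= ? ? -> -> ->; lia. Qed.

Lemma modN_bound s k : (0 <= (k %% N s)%Z)%R && ((k %% N s)%Z < N s)%R.
Proof. by have := N_gt0 s; lia. Qed.

Lemma reduced_xact s k w : reduced w.1 -> reduced (xact s k w).1.
Proof.
move=> rw; rewrite /xact /=; have /andP[? ?] := modN_bound s (head_exp s w.1 + k)%R.
have /andP[? ?] := reduced_strip s rw.
by apply: reduced_glue => //; rewrite ?reduced_cshift ?starts_cshift.
Qed.

Lemma xactE s k r u h : (0 <= r)%R -> (r < N s)%R -> ~~ starts s u ->
  xact s k (glue s r u, h) =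
  (glue s ((r + k)%R %% N s)%Z (cact s ((r + k)%R %/ N s)%Z (u, h)).1,
   (cact s ((r + k)%R %/ N s)%Z (u, h)).2).
Proof. by move=> ? ? nu; rewrite /xact /= head_glue // strip_glue. Qed.

Lemma xactD s j k w : reduced w.1 -> xact s (j + k)%R w = xact s j (xact s k w).
Proof.
move=> rw; have /andP[rs ns] := reduced_strip s rw.
have N0 : Posz (N s) != 0%R by have := N_gt0 s; lia.
set e := head_exp s w.1; set v := (strip s w.1, w.2).
have xE l : xact s l w = (glue s ((e + l)%R %% N s)%Z
    (cact s ((e + l)%R %/ N s)%Z v).1, (cact s ((e + l)%R %/ N s)%Z v).2) by [].
have /andP[? ?] := modN_bound s (e + k)%R.
rewrite !xE xactE ?starts_cshift // -surjective_pairing -cactD.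
have E : (((e + k)%R %% N s)%Z + j)%R =
    (- ((e + k)%R %/ N s)%Z * N s + (e + (j + k)))%R.
  by have := divz_eq (e + k)%R (N s); lia.
rewrite E modzMDl divzMDl //.
set q := ((e + k)%R %/ N s)%Z; set p := ((e + (j + k))%R %/ N s)%Z.
by have -> : (- q + p + q)%R = p by lia.
Qed.

Lemma xact0 s w : reduced w.1 -> xact s 0%R w = w.
Proof.
case: w => u h /= ru; have /andP[? ?] := head_exp_bound s ru.
rewrite /xact /= addr0 modz_small ?divz_small; try (apply/andP; split; lia).
by rewrite cshift0 tail_add0 if_same glue_strip.
Qed.

Lemma cact_glue s k r u h :
  cact s k (glue s r u, h) = (glue s r (cact s k (u, h)).1, (cact s k (u, h)).2).
Proof. by rewrite /cact /glue /=; case: eqP => //= _; rewrite eqxx. Qed.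

(** The N s-th power of x_s acts as c_s, which makes the actions of a^m and b^n
    commute because [cact true] and [cact false] do. *)
Lemma xactN s k w : reduced w.1 -> xact s (Posz (N s) * k)%R w = cact s k w.
Proof.
case: w => u h /= ru; have /andP[? ?] := head_exp_bound s ru.
have N0 := N_gt0 s.
have N0' : Posz (N s) <> 0%R by lia.
rewrite /xact /= addrC mulrC modzMDl divzMDl; last exact/eqP.
rewrite modz_small ?divz_small; try (apply/andP; split; lia).
by rewrite addr0 -[X in _ = cact _ _ (X, _)](glue_strip s ru) cact_glue.
Qed.

End Reduced.

(** * The normal form *)

Definition gen_side (c : gen_ab) : bool := if c is Gen_a then true else false.
Definition side_gen s : gen_ab := if s then Gen_a else Gen_b.

Lemma gen_sideK : cancel gen_side side_gen. Proof. by case. Qed.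
Lemma side_genK : cancel side_gen gen_side. Proof. by case. Qed.

Section NormalForm.
Variable N : bool -> nat.
Hypothesis N_gt0 : forall s, (0 < N s)%N.
Implicit Types (s t : bool) (j k z i r : int) (u v : seq syllable) (w : state).

Notation G := (Gmn (N true) (N false)).
Implicit Types g f : G.

Definition gx s : G := pgen _ (side_gen s).
Definition gc s : G := gx s ^+ N s.

Definition lact (l : gen_ab * bool) w : state :=
  xact N (gen_side l.1) (if l.2 then - 1 else 1)%R w.
Definition wact (p : word gen_ab) w : state := foldr lact w p.

Lemma reduced_lact l w : reduced N w.1 -> reduced N (lact l w).1.
Proof. exact: reduced_xact. Qed.

Lemma reduced_wact p w : reduced N w.1 -> reduced N (wact p w).1.
Proof. by move=> rw; elim: p => [|l p IHp] //=; apply: reduced_lact. Qed.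

Lemma wactM p q w : wact (p * q) w = wact p (wact q w).
Proof. by rewrite /wact -foldr_cat. Qed.

Lemma wactK p w : reduced N w.1 -> wact (p * p^-1) w = w.
Proof.
elim: p w => [|[c e] p IHp] w rw //.
have -> : (((c, e) :: p) : word gen_ab)^-1 = (p : word gen_ab)^-1 * ([:: (c, ~~ e)] : word gen_ab).
  exact: (word_invM [:: (c, e)] p).
rewrite !wactM [wact (_ :: _) _]/= -wactM IHp; last exact: reduced_lact.
by rewrite /= /lact /= -xactD //; case: e; rewrite /= ?addNr ?subrr xact0.
Qed.

Lemma wactVK p w : reduced N w.1 -> wact p^-1 (wact p w) = w.
Proof. by move=> rw; rewrite -wactM -[X in _ * X]invgK wactK. Qed.

Lemma wactX s (k : nat) w : reduced N w.1 ->
  wact (letter (side_gen s) ^+ k) w = xact N s k%:Z w.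
Proof.
move=> rw; elim: k => [|k IHk]; first by rewrite xact0.
rewrite expgS wactM IHk /= /lact /= side_genK -xactD //.
Qed.

(** The action on words factors through the group: this is the van der Waerden
    argument for uniqueness of normal forms. *)
Lemma wact_csq p q w : consequence (Gmn_relations (N true) (N false)) p q ->
  reduced N w.1 -> wact p w = wact q w.
Proof.
move=> pq; elim: pq w => {p q} // [p q _ IH|p q r _ IH1 _ IH2|p p' q q' _ IHp _ IHq|p|p q].
- by move=> w /IH.
- by move=> w rw; rewrite IH1 // IH2.
- by move=> w rw; rewrite !wactM IHq // IHp //; apply: reduced_wact.
- by move=> w rw; rewrite wactK.
rewrite inE => /eqP[-> ->] w rw; set a := letter Gen_a ^+ _; set b := letter Gen_b ^+ _.
have ab : wact (a * b) w = wact (b * a) w.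
  rewrite !wactM /a /b -[Gen_a]/(side_gen true) -[Gen_b]/(side_gen false).
  rewrite !wactX ?reduced_xact // -[Posz (N true)]mulr1 -[Posz (N false)]mulr1.
  by rewrite !xactN ?reduced_cact // cactC.
have -> : [~ a, b] = (b * a)^-1 * (a * b) by rewrite invgM -mulgA.
by rewrite wactM ab wactVK.
Qed.

Definition gact g w := wact (word_repr g) w.

Lemma gact_class p w : reduced N w.1 -> gact (word_class _ p) w = wact p w.
Proof. by apply: wact_csq; exact: repr_csq. Qed.

Lemma reduced_gact g w : reduced N w.1 -> reduced N (gact g w).1.
Proof. exact: reduced_wact. Qed.

Lemma gactM g f w : reduced N w.1 -> gact (g * f) w = gact g (gact f w).
Proof.
move=> rw; rewrite -[g]word_reprK -[f]word_reprK -word_classM.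
by rewrite !gact_class ?wactM //; apply: reduced_gact.
Qed.

Lemma gact1 w : reduced N w.1 -> gact 1 w = w.
Proof. by move=> rw; rewrite -word_class1 gact_class. Qed.

Lemma gactXn s n w : reduced N w.1 -> gact (gx s ^+ n) w = xact N s n w.
Proof.
move=> rw; rewrite -wactX // -gact_class //; congr gact.
by rewrite -word_eval_pgen !word_evalE.
Qed.

Lemma gactX s k w : reduced N w.1 -> gact (gx s ^% k) w = xact N s k w.
Proof.
case: k => n rw; first exact: gactXn.
have rx : reduced N (xact N s (Negz n) w).1 by apply: reduced_xact.
rewrite -[in LHS](_ : gact (gx s ^+ n.+1) (xact N s (Negz n) w) = w); last first.
  by rewrite gactXn // -xactD //= (_ : (Posz n.+1 + Negz n)%R = 0%R) ?xact0 //; lia.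
by rewrite -gactM // mulVg gact1.
Qed.

Lemma gactC s k w : reduced N w.1 -> gact (gc s ^% k) w = cact s k w.
Proof. by move=> rw; rewrite /gc -[gx s ^+ _]/(gx s ^% N s) -zexpM gactX // xactN. Qed.

Lemma commute_gc_gx s : commute (gc s) (gx s).
Proof. exact/commute_sym/commuteX. Qed.

Lemma commute_gc s t : commute (gc s) (gc t).
Proof.
have C : commute (gc true) (gc false).
  apply/eqP; rewrite -[_ == _]/(_ == _); apply/eqP/commgP/eqP.
  rewrite /gc -(@word_class1 _ (Gmn_relations (N true) (N false))).
  have := @csq_rel _ (Gmn_relations (N true) (N false)) _ _ (mem_head _ _).
  move/word_class_eqP => <-; rewrite -word_eval_pgen.
  by rewrite /commg /conjg !word_evalE.
by case: s; case: t => //; apply: commute_sym.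
Qed.

Fixpoint evl u : G :=
  if u is (s, z, i) :: u' then gc (~~ s) ^% z * gx s ^% i * evl u' else 1.
Definition evt (h : int * int) : G := gc true ^% h.1 * gc false ^% h.2.
Definition ev w : G := evl w.1 * evt w.2.

Lemma evt_add s k (h : int * int) : evt (tail_add s k h) = gc s ^% k * evt h.
Proof.
have cc := commute_zexp2 _ _ (commute_gc _ _).
by case: s; rewrite /evt /tail_add /= zexpD !mulgA;
  [rewrite cc | rewrite [X in _ = X * _]cc -!mulgA [X in _ * X]cc].
Qed.

Lemma ev_cact s k w : ev (cact s k w) = gc s ^% k * ev w.
Proof.
case: w => u h; rewrite /ev /cact /=; elim: u => [|[[s' z] i] u IHu] /=.
  by rewrite !mul1g evt_add.
case: eqP => [->|/eqP ss'] /=.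
  have C : commute (gc s ^% k) (gc (~~ s) ^% z * gx s ^% i).
    apply: commuteM; apply: commute_zexp2; [exact: commute_gc|].
    exact: commute_gc_gx.
  by rewrite -[LHS]mulgA IHu mulgA -C !mulgA.
have -> : ~~ s' = s by move: ss'; case: (s); case: (s').
by rewrite addrC zexpD !mulgA.
Qed.

Lemma ev_glue s r u h : ev (glue s r u, h) = gx s ^% r * ev (u, h).
Proof.
by rewrite /ev /glue; case: eqP => [->|_] /=; rewrite ?mul1g // !mulgA.
Qed.

Lemma ev_xact s k w : reduced N w.1 -> ev (xact N s k w) = gx s ^% k * ev w.
Proof.
case: w => u h ru; rewrite -[in RHS](glue_strip s (u := u) ru).
set e := head_exp s u; set v := strip s u.
have -> : xact N s k (u, h) = (glue s ((e + k)%R %% N s)%Z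
    (cact s ((e + k)%R %/ N s)%Z (v, h)).1, (cact s ((e + k)%R %/ N s)%Z (v, h)).2).
  by [].
rewrite !ev_glue -surjective_pairing ev_cact [LHS]mulgA [RHS]mulgA; congr (_ * _).
rewrite /gc -[gx s ^+ _]/(gx s ^% N s) -zexpM -!zexpD; congr (_ ^% _).
by have := divz_eq (e + k)%R (N s); lia.
Qed.

Lemma ev_gact g w : reduced N w.1 -> ev (gact g w) = g * ev w.
Proof.
move=> rw; rewrite -[g]word_reprK -[in RHS]word_eval_pgen gact_class //.
elim: (word_repr g) => [|[c e] p IHp]; first by rewrite word_eval_nil mul1g.
rewrite word_eval_cons /= ev_xact ?reduced_wact // IHp mulgA; congr (_ * _ * _).
by rewrite /gx gen_sideK; case: e.
Qed.

Definition nf g := gact g ([::], (0%R, 0%R)).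

Lemma nfK g : ev (nf g) = g.
Proof. by rewrite ev_gact // /ev /evt /= !mulg1. Qed.

Lemma reduced_nf g : reduced N (nf g).1.
Proof. exact: reduced_gact. Qed.

Lemma nfM g f : nf (g * f) = gact g (nf f).
Proof. exact: gactM. Qed.

Lemma nfX s k g : nf (gx s ^% k * g) = xact N s k (nf g).
Proof. by rewrite nfM gactX // reduced_nf. Qed.

Lemma nfC s k g : nf (gc s ^% k * g) = cact s k (nf g).
Proof. by rewrite nfM gactC // reduced_nf. Qed.

(** Uniqueness of the normal form: the element coded by a reduced state sends
    the empty state to that very state. *)
Lemma evK w : reduced N w.1 -> nf (ev w) = w.
Proof.
case: w => u [p q]; rewrite /ev /=; elim: u => [_|[[s z] i] u IHu /=].
  rewrite mul1g /evt /= nfC -[gc false ^% q]mulg1 nfC /nf gact1 //.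
  by rewrite /cact /= /tail_add /= !add0r.
case/and4P=> i0 iN nu ru; rewrite -!mulgA nfC nfX IHu // /xact /=.
rewrite head_exp_nostart // add0r modz_small ?divz_small; try (apply/andP; split; lia).
rewrite /strip (negbTE nu) cshift0 tail_add0 if_same /glue /cact /=.
have -> : (i == 0%R) = false by lia.
by rewrite /=; case: s nu {i0 iN} => _ /=; rewrite add0r.
Qed.

Lemma nf_inj : injective nf.
Proof. exact: can_inj nfK. Qed.

End NormalForm.

Arguments gx : clear implicits.
Arguments gc : clear implicits.
Arguments gact : clear implicits.
Arguments evl : clear implicits.
Arguments evt : clear implicits.
Arguments ev : clear implicits.
Arguments nf : clear implicits.
Arguments ev N w : simpl never.

(** * Length functions and roots *)

(** A length function satisfying the four-point inequality comes from an action
    on a tree, d(g, h) = len (g^-1 h) being a distance between points of an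
    orbit. *)
Section LengthFunction.
Variables (G : groupType) (len : G -> nat).
Implicit Types (x y z : G) (n k : nat).
Hypothesis len1 : len 1 = 0%N.
Hypothesis lenV : forall x, len x^-1 = len x.
Hypothesis len_4point : forall x y z t,
  (len (x^-1 * y) + len (z^-1 * t) <=
   maxn (len (x^-1 * z) + len (y^-1 * t)) (len (x^-1 * t) + len (y^-1 * z)))%N.

Let lenF x y : len (x^-1 * y) = len (y^-1 * x).
Proof. by rewrite -lenV invgM invgK. Qed.

Let lenX_diff x j k l : (j + k)%N = l -> len ((x ^+ j)^-1 * x ^+ l) = len (x ^+ k).
Proof. by move<-; rewrite expgnDr mulKg. Qed.

(** If len does not grow from x to x^2, then x fixes a point of the tree and
    all its powers move the base point by at most len x. *)
Lemma len_pow_bounded x n : (len (x ^+ 2) <= len x)%N -> (len (x ^+ n) <= len x)%N.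
Proof.
move=> x2; elim/ltn_ind: n => [[|[|[|n]]]] IHn //; rewrite ?len1 //.
have H1 := IHn n.+1 (ltnW (ltnSn _)); have H2 := IHn n.+2 (ltnSn _).
have := len_4point (x ^+ 0) (x ^+ n.+3) (x ^+ 1) (x ^+ 2).
rewrite (lenF (x ^+ n.+3) (x ^+ 2)) (lenF (x ^+ n.+3) (x ^+ 1)).
rewrite (lenX_diff x (erefl (0 + n.+3)%N)) (lenX_diff x (erefl (0 + 2)%N)).
rewrite (lenX_diff x (erefl (0 + 1)%N)) (lenX_diff x (erefl (1 + 1)%N)).
rewrite (lenX_diff x (erefl (2 + n.+1)%N)) (lenX_diff x (erefl (1 + n.+2)%N)) expg1.
lia.
Qed.

(** Otherwise x translates along an axis by len (x^2) - len x, the remaining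
    part of len x being twice the distance from the base point to the axis. *)
Lemma len_pow_linear x n : (len x < len (x ^+ 2))%N ->
  (len (x ^+ n.+1) + n * len x = len x + n * len (x ^+ 2))%N.
Proof.
move=> x2; elim/ltn_ind: n => [[|[|n]]] IHn //; first by lia.
have H0 := IHn n (ltnW (ltnSn _)); have H1 := IHn n.+1 (ltnSn _).
have P0 := len_4point (x ^+ 0) (x ^+ 1) (x ^+ n.+2) (x ^+ n.+3).
have P1 := len_4point (x ^+ 0) (x ^+ n.+3) (x ^+ 1) (x ^+ n.+2).
have P2 := len_4point (x ^+ 0) (x ^+ n.+2) (x ^+ 1) (x ^+ n.+3).
have E := lenX_diff x.
have E1 : len ((x ^+ 1)^-1 * x ^+ n.+2) = len (x ^+ n.+1) by apply: E.
have E2 : len ((x ^+ 1)^-1 * x ^+ n.+3) = len (x ^+ n.+2) by apply: E.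
have E3 : len ((x ^+ n.+2)^-1 * x ^+ n.+3) = len (x ^+ 1) by apply: E; lia.
have E0 k : len ((x ^+ 0)^-1 * x ^+ k) = len (x ^+ k) by apply: E.
rewrite !E0 ?(lenF (x ^+ n.+3)) ?(lenF (x ^+ n.+2) (x ^+ 1)) in P0 P1 P2.
rewrite ?E1 ?E2 ?E3 ?expg1 in P0 P1 P2.
nia.
Qed.

(** The hypothesis on x^2 says that the base point p lies on the axis of x.  The
    powers of y^k = x^k grow linearly, so y also translates along this axis, by
    the same length and in the same direction; hence x and y send p to the same
    point. *)
Lemma root_unique_len x y k : (0 < k)%N -> (0 < len x)%N ->
  len (x ^+ 2) = (2 * len x)%N -> x ^+ k = y ^+ k -> len (x^-1 * y) = 0%N.
Proof.
move=> k0 x0 x2 xy.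
have Lx n : len (x ^+ n) = (n * len x)%N.
  case: n => [|n]; first by rewrite len1.
  by have := @len_pow_linear x n; rewrite x2; nia.
have Ly n : len (y ^+ (k * n)) = (k * n * len x)%N by rewrite expgnA -xy -expgnA Lx.
(* otherwise the powers of y, hence those of x, would have bounded length *)
have y2 : (len y < len (y ^+ 2))%N.
  rewrite ltnNge; apply/negP => /(len_pow_bounded (k * (len y).+1)%N).
  by rewrite Ly; nia.
have [yL y2L] : len y = len x /\ len (y ^+ 2) = (2 * len x)%N.
  have := len_pow_linear (k * 1).-1 y2; have := len_pow_linear (k * 2).-1 y2.
  rewrite !prednK ?muln_gt0 ?k0 // !Ly; nia.
have Ly' n : len (y ^+ n) = (n * len x)%N.
  case: n => [|n]; first by rewrite len1.
  by have := len_pow_linear n y2; rewrite y2L yL; nia.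
(* x p and y p both lie between p and x^k p, at distance len x from p *)
have := len_4point x y 1 (x ^+ k); rewrite invg1 !mul1g !mulg1 !lenV.
case: k k0 xy {Ly} => // k _ xy.
have -> : len (x^-1 * x ^+ k.+1) = (k * len x)%N by rewrite expgS mulKg.
have -> : len (y^-1 * x ^+ k.+1) = (k * len x)%N by rewrite xy expgS mulKg.
by rewrite Lx yL; lia.
Qed.

End LengthFunction.

(** * The tree of reduced sequences *)

Section Tree.
Implicit Types (s t : bool) (j k z i r : int) (u v : seq syllable) (w : state).

(** Common prefix, counting 2 for a common syllable and 1 when only the power of
    c_(~s) and the side agree: the two paths then reach the same coset of the
    group generated by x_s, but leave it through different cosets of H. *)
Fixpoint lcp u v : nat :=
  match u, v with
  | (s, z, i) :: u', (s', z', i') :: v' =>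
    if (s == s') && (z == z') then if i == i' then (lcp u' v').+2 else 1%N else 0%N
  | _, _ => 0%N
  end.

Definition dist u v := (size u + size v - lcp u v)%N.

Lemma lcpC u v : lcp u v = lcp v u.
Proof.
elim: u v => [|[[s z] i] u IHu] [|[[s' z'] i'] v] //=.
by rewrite (eq_sym s) (eq_sym z) (eq_sym i) IHu.
Qed.

Lemma lcp_size u v : (lcp u v <= 2 * size u)%N.
Proof.
elim: u v => [|[[s z] i] u IHu] [|[[s' z'] i'] v] //=.
by have := IHu v; case: andP => // _; case: eqP => _; lia.
Qed.

(** Two paths that branch off a third one late agree for a long time. *)
Lemma lcp_ultrametric u v (w : seq syllable) : (minn (lcp u v) (lcp v w) <= lcp u w)%N.
Proof.
elim: u v w => [|[[s z] i] u IHu] [|[[s' z'] i'] v] [|[[t y] j] w] //=; rewrite ?minn0 ?min0n //.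
have := IHu v w.
case: (s =P s') => [->|_] /=; last by rewrite min0n.
case: (z =P z') => [->|_] /=; last by rewrite min0n.
case: (s' =P t) => [_|_] /=; last by rewrite minn0.
case: (z' =P y) => [_|_] /=; last by rewrite minn0.
case: (i =P i') => [->|ne]; first by case: (i' =P j) => _; lia.
by case: (i' =P j) => [<-|_]; case: eqP => //; lia.
Qed.

(** The sizes cancel, so that this only expresses the ultrametric property of
    [lcp]. *)
Lemma dist_4point u v (w x : seq syllable) :
  (dist u v + dist w x <= maxn (dist u w + dist v x) (dist u x + dist v w))%N.
Proof.
have S y y' : (lcp y y' <= size y + size y')%N.
  by have := lcp_size y y'; have := lcp_size y' y; rewrite (lcpC y'); lia.
rewrite /dist; move: (S u v) (S w x) (S u w) (S v x) (S u x) (S v w).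
move: (lcp_ultrametric u w v) (lcp_ultrametric u x v).
move: (lcp_ultrametric w u x) (lcp_ultrametric w v x).
rewrite (lcpC w u) (lcpC w v) (lcpC x v).
lia.
Qed.

Lemma lcp_cshift s k u v : lcp (cshift s k u) (cshift s k v) = lcp u v.
Proof.
elim: u v => [|[[s1 z] i] u IHu] [|[[s2 z'] i'] v] //=.
  by case: ifP.
have [/eqP-> | n1] := boolP (s1 == s); have [/eqP-> | n2] := boolP (s2 == s); rewrite /=.
- by rewrite IHu.
- by rewrite eq_sym (negbTE n2).
- by rewrite (negbTE n1).
- by have -> : ((z + k)%R == (z' + k)%R) = (z == z') by lia.
Qed.

Lemma dist_cshift s k u v : dist (cshift s k u) (cshift s k v) = dist u v.
Proof. by rewrite /dist !size_cshift lcp_cshift. Qed.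

Lemma lcp_nostart s r u v : ~~ starts s u -> lcp u ((s, 0%R, r) :: v) = 0%N.
Proof. by case: u => [|[[s1 z] i] u] //= /negbTE->. Qed.

Lemma dist_glue s r r' u v : ~~ starts s u -> ~~ starts s v ->
  dist (glue s r u) (glue s r' v) =
  if r == r' then dist u v else (size u + size v).+1.
Proof.
rewrite /dist /glue => nu nv.
case: (r =P 0%R) => [->|r0]; case: (r' =P 0%R) => [->|r0'].
- by rewrite eqxx.
- by rewrite lcp_nostart // eq_sym (introF eqP r0') /=; lia.
- by rewrite lcpC lcp_nostart // (introF eqP r0) /=; lia.
- by rewrite /= !eqxx /=; case: eqP => _; lia.
Qed.

End Tree.

Section TreeAction.
Variable N : bool -> nat.
Hypothesis N_gt0 : forall s, (0 < N s)%N.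
Implicit Types (s t : bool) (j k z i r : int) (u v : seq syllable) (w : state).

(** In the coordinates given by [head_exp] and [strip] the action of x_s^k only
    rotates the branches at one vertex, and moves each branch by a power of
    c_s; [dist_glue] expresses the distance in these coordinates. *)
Lemma dist_xact s k w w' : reduced N w.1 -> reduced N w'.1 ->
  dist (xact N s k w).1 (xact N s k w').1 = dist w.1 w'.1.
Proof.
case: w w' => [u h] [v h'] /= ru rv.
have /andP[_ nu] := reduced_strip s ru; have /andP[_ nv] := reduced_strip s rv.
rewrite -[in RHS](glue_strip s ru) -[in RHS](glue_strip s rv) /xact /=.
rewrite !dist_glue ?starts_cshift // !size_cshift.
have := head_exp_bound N_gt0 s ru; have := head_exp_bound N_gt0 s rv.
set e := head_exp s u; set e' := head_exp s v; move=> /andP[? ?] /andP[? ?].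
case: (e =P e') => [->|ne]; first by rewrite eqxx dist_cshift.
case: eqP => // E; case: ne.
have := divz_eq (e + k)%R (N s); have := divz_eq (e' + k)%R (N s); rewrite E.
set q := (_ %/ _)%Z; set q' := (_ %/ _)%Z; move=> E1 E2.
have [qq|[qq|qq]] : (q < q')%R \/ (q' < q)%R \/ q = q' by lia.
- nia.
- nia.
- by move: E1 E2; rewrite qq; lia.
Qed.

Notation G := (Gmn (N true) (N false)).
Implicit Types g f : G.

Definition len g := size (nf N g).1.

Lemma dist_wact p w w' : reduced N w.1 -> reduced N w'.1 ->
  dist (wact N p w).1 (wact N p w').1 = dist w.1 w'.1.
Proof.
move=> rw rw'; elim: p => [|l p IHp] //=.
by rewrite dist_xact ?reduced_wact.
Qed.

Lemma dist_nf g f : dist (nf N g).1 (nf N f).1 = len (g^-1 * f).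
Proof.
rewrite -(dist_wact (word_repr g^-1)) ?reduced_nf // -![wact N _ _]/(gact N g^-1 _).
by rewrite -!nfM // mulVg /nf gact1 // /dist /= subn0.
Qed.

Lemma len1 : len 1 = 0%N.
Proof. by rewrite /len /nf gact1. Qed.

Lemma lenV g : len g^-1 = len g.
Proof.
rewrite -[g in RHS]mul1g -[in RHS]invg1 -dist_nf /dist lcpC addnC.
by rewrite -[RHS]/(dist _ _) dist_nf mulg1.
Qed.

Lemma len_4point g1 g2 g3 g4 :
  (len (g1^-1 * g2) + len (g3^-1 * g4) <=
   maxn (len (g1^-1 * g3) + len (g2^-1 * g4))
        (len (g1^-1 * g4) + len (g2^-1 * g3)))%N.
Proof. by rewrite -!dist_nf dist_4point. Qed.

(** The stabiliser of the base point is H. *)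
Lemma len_eq0P g : len g = 0%N <-> exists h, g = evt N h.
Proof.
split=> [g0|[h ->]].
  exists (nf N g).2; rewrite -[LHS](nfK N_gt0) /ev.
  by move: g0; rewrite /len; case: (nf N g).1 => //=; rewrite mul1g.
by rewrite /len -[evt N h]mul1g -[_ * _]/(ev N ([::], h)) evK.
Qed.

End TreeAction.

Arguments len : clear implicits.

(** * Exponent sums *)

Section ExponentSums.
Variable N : bool -> nat.
Implicit Types (s t : bool) (j k : int).
Notation G := (Gmn (N true) (N false)).
Implicit Types g f : G.

(** Exponent sum of the generator of side s; both sums vanish on the relator. *)
Fixpoint wsum s (p : word gen_ab) : int :=
  if p is (c, e) :: p' then
    ((if gen_side c == s then if e then -1 else 1 else 0) + wsum s p')%R
  else 0%R.

Lemma wsumM s p q : wsum s (p * q) = (wsum s p + wsum s q)%R.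
Proof.
rewrite -[p * q]/(p ++ q); elim: p => [|[c e] p IHp] /=; first by rewrite add0r.
by rewrite IHp addrA.
Qed.

Lemma wsumV s p : wsum s p^-1 = (- wsum s p)%R.
Proof.
elim: p => [|[c e] p IHp] //.
have -> : (((c, e) :: p) : word gen_ab)^-1 = (p : word gen_ab)^-1 * ([:: (c, ~~ e)] : word gen_ab).
  exact: (word_invM [:: (c, e)] p).
by rewrite wsumM IHp /=; case: ifP; case: e => _ /=; lia.
Qed.

Lemma wsum_csq s p q :
  consequence (Gmn_relations (N true) (N false)) p q -> wsum s p = wsum s q.
Proof.
elim=> {p q} // [p q r _ -> _ -> //|p p' q q' _ IHp _ IHq|p|p q].
- by rewrite !wsumM IHp IHq.
- by rewrite wsumM wsumV subrr.
rewrite inE => /eqP[-> ->]; rewrite /commg /conjg !wsumM !wsumV.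
rewrite -[wsum s 1]/(0%R : int); lia.
Qed.

Definition esum s g : int := wsum s (word_repr g).

Lemma esum_class s p : esum s (word_class _ p) = wsum s p.
Proof. by apply: wsum_csq; exact: repr_csq. Qed.

Lemma esumM s g f : esum s (g * f) = (esum s g + esum s f)%R.
Proof.
by rewrite -[g]word_reprK -[f]word_reprK -word_classM !esum_class wsumM.
Qed.

Lemma esum1 s : esum s 1 = 0%R.
Proof. by rewrite -word_class1 esum_class. Qed.

Lemma esumV s g : esum s g^-1 = (- esum s g)%R.
Proof. by have := esumM s g^-1 g; rewrite mulVg esum1; lia. Qed.

Lemma esumJ s g f : esum s (g ^ f) = esum s g.
Proof. by rewrite conjgE !esumM esumV; lia. Qed.

Lemma esum_zexp s g k : esum s (g ^% k) = (esum s g * k)%R.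
Proof.
elim/int_rect: k => [|n IHn|n IHn]; first by rewrite esum1 mulr0.
- have -> : Posz n.+1 = (Posz n + 1)%R by lia.
  by rewrite zexpS esumM IHn; lia.
- have -> : (- Posz n.+1)%R = (- Posz n + - 1)%R by lia.
  by rewrite zexpD esumM IHn zexpN zexp1 esumV; lia.
Qed.

Lemma esum_gx s t : esum s (gx N t) = (if t == s then 1 else 0)%R.
Proof. by rewrite /gx /pgen esum_class /= side_genK addr0. Qed.

Lemma esum_gc s t : esum s (gc N t) = (if t == s then Posz (N t) else 0)%R.
Proof.
by rewrite /gc -[_ ^+ _]/(_ ^% N t) esum_zexp esum_gx; case: eqP => _; lia.
Qed.

Lemma esum_evt s h : esum s (evt N h) = (Posz (N s) * tail_exp s h)%R.
Proof. by rewrite esumM !esum_zexp !esum_gc; case: s => /=; lia. Qed.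

(** H embeds in the abelianisation. *)
Lemma evt_eq1 h : (forall s, 0 < N s)%N ->
  (forall s, esum s (evt N h) = 0%R) -> evt N h = 1.
Proof.
move=> N_gt0 h0; have := h0 true; have := h0 false; rewrite !esum_evt /=.
by case: h {h0} => p q /= q0 p0; rewrite /evt (_ : p = 0%R) 1?(_ : q = 0%R) ?mul1g //;
  have := N_gt0 true; have := N_gt0 false; nia.
Qed.

End ExponentSums.

(** * Conjugacy *)

Section Structure.
Variable N : bool -> nat.
Hypothesis N_gt0 : forall s, (0 < N s)%N.
Implicit Types (s t : bool) (j k z i r : int) (u v : seq syllable) (w : state).
Notation G := (Gmn (N true) (N false)).
Notation gx := (gx N).
Notation gc := (gc N).
Notation nf := (nf N).
Notation ev := (ev N).
Notation evl := (evl N).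
Notation evt := (evt N).
Notation len := (len N).
Implicit Types g f : G.

Definition hact (h : int * int) w := cact true h.1 (cact false h.2 w).
Arguments hact h w : simpl never.

Lemma ev_hact h w : ev (hact h w) = evt h * ev w.
Proof. by rewrite !ev_cact mulgA. Qed.

Lemma reduced_hact h w : reduced N (hact h w).1 = reduced N w.1.
Proof. by rewrite !reduced_cact. Qed.

Lemma size_hact h w : size (hact h w).1 = size w.1.
Proof. by rewrite !size_cshift. Qed.

Lemma nf_hact h g : nf (evt h * g) = hact h (nf g).
Proof. by rewrite -mulgA !nfC. Qed.

Lemma hact_cons h s z i u h' :
  exists v h'', hact h ((s, z, i) :: u, h') =
    ((s, (z + tail_exp (~~ s) h)%R, i) :: v, h'').
Proof.
by case: s; case: h => p q; rewrite /hact /cact /=; do 2!eexists.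
Qed.

(** The condition at the junction for a concatenation of reduced sequences to be
    reduced. *)
Definition joinable u v := if u is l :: u' then ~~ starts (last l u').1.1 v else true.

Lemma reduced_cat u v :
  reduced N (u ++ v) = [&& reduced N u, reduced N v & joinable u v].
Proof.
elim: u => [|[[s z] i] u IHu] /=; first by rewrite andbT.
rewrite IHu; case: u {IHu} => [|[[t y] j] u] /=; last by rewrite !andbA.
by rewrite !andbT; case: (0 < i)%R; case: (i < N s)%R => //=; rewrite andbC.
Qed.

Lemma evl_cat u v : evl (u ++ v) = evl u * evl v.
Proof. by elim: u => [|[[s z] i] u IHu] /=; rewrite ?mul1g // IHu !mulgA. Qed.

Lemma evl_cons0 s z i u :
  evl ((s, z, i) :: u) = gc (~~ s) ^% z * evl ((s, 0%R, i) :: u).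
Proof. by rewrite /= expg0 mul1g !mulgA. Qed.

Lemma evl_ev u v h : evl u * ev (v, h) = ev (u ++ v, h).
Proof. by rewrite /ev evl_cat mulgA. Qed.

Lemma ev_cat u h w : ev (u, h) * ev w = ev (u ++ (hact h w).1, (hact h w).2).
Proof. by rewrite -mulgA -ev_hact /ev evl_cat mulgA. Qed.

Lemma len_ev w : reduced N w.1 -> len (ev w) = size w.1.
Proof. by move=> rw; rewrite /len evK. Qed.

Lemma evt_single s k : evt (tail_add s k (0%R, 0%R)) = gc s ^% k.
Proof. by rewrite evt_add /evt !zexp0 !mulg1. Qed.

Lemma evtE s h : evt h = gc s ^% tail_exp s h * gc (~~ s) ^% tail_exp (~~ s) h.
Proof. by case: s => //=; apply/commute_zexp2/commute_gc. Qed.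

Lemma ev_single s k u : ev (u, tail_add s k (0%R, 0%R)) = evl u * gc s ^% k.
Proof. by rewrite /ev evt_single. Qed.

Lemma zexp_gc s k : gc s ^% k = gx s ^% (Posz (N s) * k)%R.
Proof. by rewrite zexpM. Qed.

Lemma size_glue s r u : (size (glue s r u) <= (size u).+1)%N.
Proof. by rewrite /glue; case: eqP. Qed.

Lemma size_strip s u : (size (strip s u) <= size u)%N.
Proof. by rewrite /strip; case: ifP => // _; rewrite size_behead leq_pred. Qed.

Lemma len_gx_mul s k g : (len (gx s ^% k * g) <= (len g).+1)%N.
Proof.
rewrite /len nfX // /xact /=; apply: leq_trans (size_glue _ _ _) _.
by rewrite ltnS size_cshift size_strip.
Qed.

(** Take a conjugate of g of minimal length.  If its normal form followed by
    itself is reduced, it translates along an axis through the base point.  If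
    not, the last syllable merges with the first one, and either there is a
    single syllable, so that g is conjugate to a power of a generator, or
    conjugating by the last syllable shortens the normal form. *)
Lemma elliptic_or_hyperbolic g : exists f x, g = x ^ f /\
  [\/ exists s k, x = gx s ^% k, exists h, x = evt h |
      (0 < len x)%N /\ len (x ^+ 2) = (2 * len x)%N].
Proof.
have [n] := ubnP (len g); elim: n g => // n IHn g; rewrite ltnS => gn.
have ru := reduced_nf N_gt0 g; have eg := nfK N_gt0 g.
have {}gn : (size (nf g).1 <= n)%N := gn.
case: (nf g) ru eg gn => u h /= ru eg gn.
case: u ru eg gn => [|[[s z] i] u] ru eg gn.
  by exists 1, g; rewrite conjg1; split=> //; apply: Or32; exists h; rewrite -eg /ev mul1g.
have [jo|] := boolP (joinable ((s, z, i) :: u) (hact h ((s, z, i) :: u, h)).1).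
  exists 1, g; rewrite conjg1; split=> //; apply: Or33; rewrite -eg len_ev //.
  split=> //; rewrite expg2 ev_cat len_ev; last first.
    by rewrite reduced_cat ru reduced_hact jo andbT.
  by rewrite -[LHS]/(size (_ ++ (hact _ _).1)) size_cat size_hact /=; lia.
have [v [h' ->]] := hact_cons h s z i u h.
rewrite /= negbK => /andP[/eqP sl /eqP z0].
have {}z0 : tail_exp (~~ s) h = (- z)%R by lia.
set y := gc (~~ s) ^% (- z)%R.
have yV : gc (~~ s) ^% z = y^-1 by rewrite /y zexpN invgK.
case/lastP: u ru eg gn sl {v h'} => [|u [[s' z'] i']] ru eg gn sl.
  exists y, (gx s ^% (i + Posz (N s) * tail_exp s h)%R); split; last first.
    by apply: Or31; exists s, (i + Posz (N s) * tail_exp s h)%R.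
  rewrite -eg /ev /= mulg1 (evtE s) z0 -/y yV zexpD -zexp_gc conjgE !mulgA.
  by [].
rewrite last_rcons /= in sl; rewrite -sl in ru eg gn.
set k := (i' + Posz (N s) * tail_exp s h)%R.
have := IHn (gx s ^% (k + i)%R * (evl u * gc (~~ s) ^% z')).
have ru1 : reduced N u.
  by move: ru; rewrite -cats1 /= => /and4P[_ _ _]; rewrite reduced_cat => /and3P[].
case=> [|t [x [xt X]]].
  apply: leq_ltn_trans (len_gx_mul _ _ _) _.
  rewrite -ev_single len_ev //=; move: gn; rewrite /= size_rcons; lia.
exists (t * (gx s ^% k * y)), x; split=> //.
rewrite conjgM -xt -eg /ev -cats1 /= evl_cat /= mulg1 (evtE s) z0 -/y yV.
rewrite zexpD conjgE [in RHS]invgM; set A := gx s ^% k.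
rewrite -!mulgA mulKg; do 4!congr (_ * _).
by rewrite mulgA /A /k zexpD -zexp_gc.
Qed.

End Structure.

(** * Centralisers *)

Section Centralisers.
Variable N : bool -> nat.
Hypothesis N_gt0 : forall s, (0 < N s)%N.
Implicit Types (s t : bool) (j k z i r : int) (u v : seq syllable) (w : state).
Notation G := (Gmn (N true) (N false)).
Notation gx := (gx N).
Notation gc := (gc N).
Notation nf := (nf N).
Notation ev := (ev N).
Notation evl := (evl N).
Notation evt := (evt N).
Notation len := (len N).
Implicit Types g f y : G.

Lemma nf_gx s k : nf (gx s ^% k) =
  (glue s (k %% N s)%Z [::], tail_add s (k %/ N s)%Z (0%R, 0%R)).
Proof.
by rewrite -[_ ^% k]mulg1 nfX // /nf gact1 // /xact /= /strip /= add0r.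
Qed.

Lemma nf_evt h : nf (evt h) = ([::], h).
Proof. by rewrite -[evt h]mul1g -[_ * _]/(ev ([::], h)) evK. Qed.

Lemma cshift_fixed s k u : k <> 0%R -> cshift s k u = u -> on_side s u.
Proof.
move=> k0; elim: u => [|[[t z] i] u IHu] //=.
by case: eqP => _ /= [] => [/IHu //|]; lia.
Qed.

Lemma cshift_on_side s k u : on_side s u -> cshift s k u = u.
Proof.
by elim: u => [|[[t z] i] u IHu] //= /andP[/eqP-> /IHu->]; rewrite eqxx.
Qed.

Lemma nf_mul_gc s k g : nf (g * gc s ^% k) = ((nf g).1, tail_add s k (nf g).2).
Proof.
rewrite -[in LHS](nfK N_gt0 g) -[RHS](evK N_gt0) ?reduced_nf //; congr nf.
rewrite /ev -mulgA; congr (_ * _); rewrite evt_add.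
apply/commute_sym/commuteM; apply: commute_zexp2; exact: commute_gc.
Qed.

(** Multiplying by c_s on the left changes the first syllable of the other side,
    whereas multiplying on the right only changes the tail. *)
Lemma commute_gcP s g : commute g (gc s) <-> on_side s (nf g).1.
Proof.
have E : nf (gc s * g) = cact s 1%R (nf g) by rewrite -[gc s]zexp1 nfC.
have F : nf (g * gc s) = ((nf g).1, tail_add s 1%R (nf g).2).
  by rewrite -[gc s]zexp1 nf_mul_gc.
split=> [C|o]; last first.
  by apply: (nf_inj N_gt0); rewrite E F /cact o cshift_on_side.
by apply: (@cshift_fixed _ 1%R) => //; move: E; rewrite -C F => -[<-].
Qed.

(** If both exponents of h are nonzero, left multiplication by h changes the first
    syllable whatever its side is, so H is the full centraliser. *)
Lemma commute_evt h g : (forall s, tail_exp s h <> 0%R) -> commute g (evt h) ->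
  exists h', g = evt h'.
Proof.
move=> h0 C; have := nf_hact N_gt0 h g.
rewrite -C {1}/(evt h) mulgA !nf_mul_gc /=.
have := nfK N_gt0 g; case: (nf g) => [[|[[s z] i] u] h'] /= <-.
  by exists h'; rewrite /ev mul1g.
have [v [h'' ->]] := hact_cons h s z i u h'.
by case=> z0; case: (h0 (~~ s)); lia.
Qed.

(** A power x_s^k outside H fixes exactly one vertex of the tree, namely the
    cyclic group generated by x_s, and the centraliser fixes this vertex.  In
    terms of lengths: g^-1 x_s^k g = x_s^k has length 1, while its length grows
    with the part of g that follows the leading power of x_s. *)
Lemma commute_gx s k g : (k %% N s)%Z <> 0%R -> commute g (gx s ^% k) ->
  exists j, g = gx s ^% j.
Proof.
move=> k0 C; have lenk : len (gx s ^% k) = 1%N.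
  by rewrite /len nf_gx /glue (introF eqP k0).
have := dist_nf N_gt0 g (gx s ^% k * g).
rewrite -C mulKg lenk C nfX // /xact /=.
have ru := reduced_nf N_gt0 g; have /andP[_ nu] := reduced_strip s ru.
rewrite -{1}(glue_strip s ru) dist_glue ?starts_cshift //.
have := nfK N_gt0 g; case: (nf g) ru nu => u h /= ru nu eg.
have /andP[e0 eN] := head_exp_bound N_gt0 s ru.
set e := head_exp s u in e0 eN *.
have ne : e != ((e + k)%R %% N s)%Z.
  apply/eqP => ee; apply: k0.
  have E := divz_eq (e + k)%R (N s); rewrite -ee in E.
  have -> : k = (((e + k)%R %/ N s)%Z * N s + 0)%R by lia.
  by rewrite modzMDl mod0z.
rewrite (negbTE ne) size_cshift => sz.
have /size0nil su : size (strip s u) = 0%N by lia.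
have {}eg : g = gx s ^% e * evt h.
  by rewrite -eg -(glue_strip s ru) ev_glue su /ev mul1g.
(* it remains to see that a power of c_(~s) commuting with x_s^k is trivial *)
have q0 : tail_exp (~~ s) h = 0%R.
  have Cq : commute (gc (~~ s) ^% tail_exp (~~ s) h) (gx s ^% k).
    have -> : gc (~~ s) ^% tail_exp (~~ s) h =
        (gc s ^% tail_exp s h)^-1 * ((gx s ^% e)^-1 * g).
      by rewrite eg mulKg (evtE N s) mulKg.
    apply/commute_sym/commuteM; last apply/commuteM; last exact/commute_sym.
      exact/commuteV/commute_zexp2/commute_sym/commute_gc_gx.
    exact/commuteV/commute_zexp2.
  have := congr1 nf Cq; rewrite nfC // nfX // nf_gx -evt_single nf_evt.
  rewrite /xact /cact /glue /= (introF eqP k0) add0r (introF eqP k0) /=.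
  by case: (s) => /= -[] *; lia.
exists (e + Posz (N s) * tail_exp s h)%R.
by rewrite eg (evtE N s) q0 zexp0 mulg1 zexpD zexpM.
Qed.

Lemma evt_axis s h : tail_exp (~~ s) h = 0%R ->
  evt h = gx s ^% (Posz (N s) * tail_exp s h)%R.
Proof. by move=> h0; rewrite (evtE N s) h0 zexp0 mulg1 zexpM. Qed.

(** For a hyperbolic g the roots g and g^f of g^n = (g^f)^n differ by an element
    of H; it is a commutator, hence trivial because its exponent sums vanish.  For
    g in H or in a cyclic factor the centraliser of g^n is that of g, unless
    g^n is a power of a single c_t. *)
Lemma commute_power_cases g f n : (0 < n)%N -> commute f (g ^+ n) ->
  commute f g \/
  exists s j y, g = (gx s ^% j) ^ y /\ ((j * n)%R %% N s)%Z = 0%R.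
Proof.
move=> n0 C; have [y [x [eg X]]] := elliptic_or_hyperbolic N_gt0 g; subst g.
rewrite -[f](conjgKV y) in C *; set f' := f ^ y^-1 in C *.
rewrite -conjXg in C; rewrite !commute_conj in C *.
suff [?|[s [j [q [-> jn]]]]] : commute f' x \/
    exists s j q, x = (gx s ^% j) ^ q /\ ((j * n)%R %% N s)%Z = 0%R.
- by left.
- by right; exists s, j, (q * y); rewrite conjgM.
case: X C => [[s [j ->]] C|[h ->] C|[x0 x2] C].
- have [jn|jn] := eqVneq ((j * n)%R %% N s)%Z 0%R.
    by right; exists s, j, 1; rewrite conjg1.
  left; rewrite -[_ ^+ n]/(_ ^% n) -zexpM in C.
  have [|i ->] := commute_gx _ C; first exact/eqP.
  exact: commute_zexp2.
- have K s : tail_exp (~~ s) h = 0%R -> exists t j q,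
      evt h = (gx t ^% j) ^ q /\ ((j * n)%R %% N t)%Z = 0%R.
    move=> h0; exists s, (Posz (N s) * tail_exp s h)%R, 1.
    by rewrite conjg1 (evt_axis h0) -mulrA modzMr.
  have [h1|/eqP h1] := eqVneq (tail_exp true h) 0%R; first by right; apply: (K false).
  have [h2|/eqP h2] := eqVneq (tail_exp false h) 0%R; first by right; apply: (K true).
  left; rewrite -[evt h ^+ n]/(evt h ^% n) zexpMg -?zexpM in C; last first.
    exact/commute_zexp2/commute_gc.
  have [|h' ->] := @commute_evt ((h.1 * n)%R, (h.2 * n)%R) f' _ C.
    by case=> /=; [move: h1|move: h2] => /=; nia.
  have CC a b c d : commute (gc a ^% c) (gc b ^% d) by apply/commute_zexp2/commute_gc.
  by apply: commuteM; apply/commute_sym/commuteM.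
left; have xf : x ^+ n = (x ^ f') ^+ n.
  by rewrite -conjXg conjgE -C mulKg.
have := root_unique_len (len1 N_gt0) (lenV N_gt0) (len_4point N_gt0) n0 x0 x2 xf.
move/(len_eq0P N_gt0) => [h eh].
have : evt h = 1.
  by apply: evt_eq1 => // s; rewrite -eh esumM esumV esumJ; lia.
rewrite -eh => /eqP; rewrite -commgEl => /commgP; exact: commute_sym.
Qed.

(** A central element commutes with a and b, hence is a power of each. *)
Lemma center_trivial g : (forall s, 1 < N s)%N -> (forall f, commute g f) -> g = 1.
Proof.
move=> N_gt1 C.
have X s : exists j, g = gx s ^% j.
  apply: (@commute_gx _ 1%R) => //; have N1 := N_gt1 s.
  by rewrite modz_small //; apply/andP; split; lia.
have [j gj] := X true; have [i gi] := X false.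
have : esum true g = j by rewrite gj esum_zexp esum_gx mul1r.
by rewrite {1}gi esum_zexp esum_gx mul0r gj => <-.
Qed.

End Centralisers.

Lemma modz_opp_neq0 (d : nat) (i : int) : (0 < i)%R -> (i < d)%R -> ((- i)%R %% d)%Z <> 0%R.
Proof.
move=> i0 id; have -> : (- i)%R = (- 1 * Posz d + (Posz d - i))%R by lia.
by rewrite modzMDl modz_small; [lia | apply/andP; split; lia].
Qed.

Section Factorisation.
Variable N : bool -> nat.
Hypothesis N_gt0 : forall s, (0 < N s)%N.
Implicit Types (s t : bool) (j k z i r : int) (u v : seq syllable) (w : state).
Notation G := (Gmn (N true) (N false)).
Notation gx := (gx N).
Notation gc := (gc N).
Notation nf := (nf N).
Notation ev := (ev N).
Notation evl := (evl N).
Notation evt := (evt N).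
Notation len := (len N).
Implicit Types g f y : G.

(** Cut before the maximal final segment of side s. *)
Lemma split_on_side s u : exists u1 u2,
  [/\ u = u1 ++ u2, on_side s u2 & forall v, on_side s v -> joinable u1 v].
Proof.
elim/last_ind: u => [|u [[t z] i] [u1 [u2 [-> o2 j1]]]].
  by exists [::], [::]; split.
have [ts|nts] := boolP (t == s).
  exists u1, (rcons u2 (t, z, i)); split=> //; first by rewrite rcons_cat.
  by rewrite /on_side all_rcons ts.
exists (rcons (u1 ++ u2) (t, z, i)), [::]; split=> // [|v]; first by rewrite cats0.
rewrite /joinable; case: (u1 ++ u2) => [|l u'] /=; rewrite ?last_rcons /=;
  case: v => [|[[t' z'] i'] v] //= /andP[/eqP-> _]; by rewrite eq_sym (negbTE nts).
Qed.

(** Let g2 be the final part of the normal form of g made of syllables of side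
    s, and g1 the rest.  As g2 centralises c_s, so does p = c_(~s)^g1; thus p
    has only syllables of side s.  Then no cancellation occurs in
    c_(~s) g1 = g1 p, and comparing sizes shows that p has no syllable and that
    c_(~s) does not change the syllables of g1. *)
Lemma commute_conj_factor s g : commute (gc s) (gc (~~ s) ^ g) ->
  exists g1 g2, [/\ g = g1 * g2, commute g1 (gc (~~ s)) & commute g2 (gc s)].
Proof.
have rg := reduced_nf N_gt0 g; have := nfK N_gt0 g.
case: (nf g) rg => u h /= rg eg.
have [u1 [u2 [eu o2 j1]]] := split_on_side s u.
move: rg; rewrite eu reduced_cat => /and3P[r1 r2 _].
have e12 : g = evl u1 * ev (u2, h) by rewrite -eg eu /ev /= evl_cat -mulgA.
have c2 : commute (ev (u2, h)) (gc s) by apply/(commute_gcP N_gt0); rewrite evK.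
rewrite e12 conjgM => C; exists (evl u1), (ev (u2, h)); split=> //.
have {}C : commute (gc s) (gc (~~ s) ^ evl u1).
  apply/(commute_conj _ _ (ev (u2, h))).
  by rewrite [X in commute X _](_ : _ = gc s) // conjgE -c2 mulKg.
have n1 : nf (evl u1) = (u1, (0%R, 0%R)).
  by rewrite -(evK N_gt0 (w := (u1, (0%R, 0%R)))) // /ev /evt !zexp0 !mulg1.
apply/(commute_gcP N_gt0); rewrite n1.
have := nfC N_gt0 (~~ s) 1%R (evl u1); rewrite zexp1 n1.
have -> : gc (~~ s) * evl u1 = evl u1 * (gc (~~ s) ^ evl u1).
  by rewrite conjgE mulVKg.
have /(commute_gcP N_gt0) := commute_sym C.
have := nfK N_gt0 (gc (~~ s) ^ evl u1); have := reduced_nf N_gt0 (gc (~~ s) ^ evl u1).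
case: (nf _) => v h' /= rv <- ov.
have -> : evl u1 * ev (v, h') = ev (u1 ++ v, h') by rewrite /ev evl_cat mulgA.
rewrite evK //=; last by rewrite reduced_cat r1 rv j1.
rewrite /cact /= => -[E _].
apply: (@cshift_fixed _ 1%R) => //; rewrite -E.
have := congr1 size E; rewrite size_cat size_cshift.
by case: v {rv ov E} => [|? ?] /=; rewrite ?cats0 //; lia.
Qed.

End Factorisation.

(** * The group with one exponent equal to 1 *)

(** Here N (~~ s) = 1, so that c_(~s) is the generator x_(~s), the element c_s is
    central, and the quotient by c_s is the free product of a cyclic group of
    order N s and an infinite cyclic group.  All syllables have side s. *)
Section OneExponent.
Variables (N : bool -> nat) (s : bool).
Hypothesis N_gt0 : forall s, (0 < N s)%N.
Hypothesis Nt1 : N (~~ s) = 1%N.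
Implicit Types (j k z i r : int) (u v : seq syllable) (w : state).
Notation G := (Gmn (N true) (N false)).
Notation gx := (gx N).
Notation gc := (gc N).
Notation nf := (nf N).
Notation ev := (ev N).
Notation evl := (evl N).
Notation evt := (evt N).
Notation len := (len N).
Implicit Types g f y : G.

Lemma reduced_on_side u : reduced N u -> on_side s u.
Proof.
elim: u => [|[[t z] i] u IHu] //= /and4P[i0 iN _ /IHu->]; rewrite andbT.
case: eqP => // ts; move: i0 iN.
have -> : t = ~~ s by move: ts; case: (t); case: (s).
by rewrite Nt1; lia.
Qed.

Lemma gc_central g : commute g (gc s).
Proof. by apply/(commute_gcP N_gt0)/reduced_on_side/reduced_nf. Qed.

Lemma gc_gx : gc (~~ s) = gx (~~ s).
Proof. by rewrite /gc Nt1 expg1. Qed.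

(** The two halves of the ping-pong: nontrivial powers of c_(~s) take elements
    starting with a power of x_s to elements that do not, and powers of x_s
    outside the group of c_s do the converse ([nf_gx_mul]). *)
Lemma starts_gc_mul k y : k <> 0%R -> starts s (nf y).1 ->
  ~~ starts s (nf (gc (~~ s) ^% k * y)).1.
Proof.
move=> k0; rewrite nfC //; case: (nf y) => [[|[[t z] i] u] h] //=.
move=> /andP[/eqP-> /eqP->]; rewrite /cact /=.
by case: (s) => /=; rewrite add0r (introF eqP k0).
Qed.

Lemma nf_gx_mul i y : (i %% N s)%Z <> 0%R -> ~~ starts s (nf y).1 ->
  exists v h, nf (gx s ^% i * y) = ((s, 0%R, (i %% N s)%Z) :: v, h).
Proof.
move=> i0 ny; rewrite nfX // /xact /= head_exp_nostart // add0r.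
by rewrite /glue (introF eqP i0); do 2!eexists.
Qed.

(** The factors of the inverse are multiplied one by one to the left of y, and the
    last one, a nontrivial power of c_(~s), leaves an element not starting with a
    power of x_s. *)
Lemma starts_inv_mul z i u q y : reduced N ((s, z, i) :: u) -> q <> 0%R ->
  ~~ starts s (nf (gc (~~ s) ^% (- z)%R * y)).1 ->
  ~~ starts s (nf ((evl ((s, z, i) :: u) * gc (~~ s) ^% q)^-1 * y)).1.
Proof.
elim: u z i y => [|[[t z'] i'] u IHu] z i y ru q0 ny.
  rewrite /= mulg1 !invgM -!mulgA -!zexpN; apply: starts_gc_mul; first by lia.
  have [|v [h ->]] := @nf_gx_mul (- i)%R _ _ ny; last by rewrite /= !eqxx.
  by move: ru => /= /and3P[? ? _]; apply: modz_opp_neq0.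
have /andP[/eqP /= ts _] : on_side s ((t, z', i') :: u).
  by apply: reduced_on_side; move: ru => /= /and4P[].
subst t; have i0 : ((- i)%R %% N s)%Z <> 0%R.
  by move: ru => /= /and4P[? ? _ _]; apply: modz_opp_neq0.
have [v [h E]] := nf_gx_mul i0 ny.
have -> : (evl [:: (s, z, i), (s, z', i') & u] * gc (~~ s) ^% q)^-1 * y =
    (evl ((s, z', i') :: u) * gc (~~ s) ^% q)^-1 *
    (gx s ^% (- i)%R * (gc (~~ s) ^% (- z)%R * y)).
  rewrite -[evl [:: _, _ & _]]/(gc (~~ s) ^% z * gx s ^% i * evl ((s, z', i') :: u)).
  by rewrite !invgM !zexpN !mulgA.
apply: IHu => //; first by move: ru => /= /and4P[].
apply: starts_gc_mul; last by rewrite E /= !eqxx.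
by move: ru => /= /and4P[_ _]; rewrite eqxx /=; lia.
Qed.

(** After multiplication by a conjugate of a noncentral power of x_s, the syllables
    of the conjugating element remain visible as a prefix. *)
Lemma nf_conj_mul i1 u q j y : reduced N ((s, 0%R, i1) :: u) -> q <> 0%R ->
  (j %% N s)%Z <> 0%R -> ~~ starts s (nf y).1 ->
  let g := evl ((s, 0%R, i1) :: u) * gc (~~ s) ^% q in
  exists v, v <> [::] /\ (nf (gx s ^% j ^ g^-1 * y)).1 = (s, 0%R, i1) :: v.
Proof.
move=> ru q0 j0 ny g.
have [|v [h E]] := @nf_gx_mul j (g^-1 * y) j0.
  by apply: starts_inv_mul; rewrite // oppr0 mul1g.
exists (u ++ (s, q, (j %% N s)%Z) :: v); split; first by case: (u).
have rv : reduced N ((s, 0%R, (j %% N s)%Z) :: v).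
  by have := reduced_nf N_gt0 (gx s ^% j * (g^-1 * y)); rewrite E.
have -> : gx s ^% j ^ g^-1 * y = g * ev ((s, 0%R, (j %% N s)%Z) :: v, h).
  by rewrite -E nfK // conjgE invgK !mulgA.
have cE : cact (~~ s) q ((s, 0%R, (j %% N s)%Z) :: v, h) =
    ((s, q, (j %% N s)%Z) :: v, h).
  by rewrite /cact /=; case: (s) => /=; rewrite add0r.
rewrite /g -mulgA -ev_cact cE evl_ev evK //.
change (reduced N (((s, 0%R, i1) :: u) ++ (s, q, (j %% N s)%Z) :: v)).
rewrite reduced_cat ru /=.
by move: rv => /= ->; case: (u) => [|l u'] /=; rewrite (introF eqP q0) andbF.
Qed.

Section Endomorphism.
Variable psi : G -> G.
Hypothesis psiM : {morph psi : x y / x * y}.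
Hypothesis psi_t : psi (gx (~~ s)) = gx (~~ s).

(** Under an endomorphism that fixes x_(~s) and conjugates x_s by the inverse of
    a reduced element with at least one syllable and a nontrivial tail, no
    cancellation takes place: each image outside H has at least two syllables. *)
Lemma nf_endomorphism i1 u q : reduced N ((s, 0%R, i1) :: u) -> q <> 0%R ->
  psi (gx s) = gx s ^ (evl ((s, 0%R, i1) :: u) * gc (~~ s) ^% q)^-1 ->
  forall v h, reduced N v ->
  if v is (t, z, _) :: _ then
    exists v', v' <> [::] /\ (nf (psi (ev (v, h)))).1 = (s, z, i1) :: v'
  else (nf (psi (ev (v, h)))).1 = [::].
Proof.
set g := _ * _ => ru q0 psi_s.
have psi_gct : psi (gc (~~ s)) = gc (~~ s) by rewrite gc_gx.
have psi_gcs : psi (gc s) = gc s.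
  by rewrite /gc (morphX psiM) psi_s -conjXg conjgE -[_ ^+ _]/(gc s) -gc_central mulKg.
elim=> [|[[t z] i] v IHv] h.
  move=> _; rewrite /ev mul1g (evtE N s) psiM !(morph_zexp psiM) psi_gct psi_gcs.
  by rewrite -evtE nf_evt.
move=> rv; have /andP[/eqP /= ts _] := reduced_on_side rv; subst t.
have [i0 iN nv rv'] : [/\ (0 < i)%R, (i < N s)%R, ~~ starts s v & reduced N v].
  by move: rv => /= /and4P.
have im : (i %% N s)%Z <> 0%R by rewrite modz_small; [lia | apply/andP; split; lia].
have ny : ~~ starts s (nf (psi (ev (v, h)))).1.
  have := IHv h rv'; have := reduced_on_side rv'; move: nv.
  case: (v) => [|[[t z'] i'] v1] /=; first by move=> _ _ ->.
  by move=> + /andP[/eqP ts _] [v' [_ ->]]; rewrite /= ts.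
have [v' [v0 E]] := nf_conj_mul ru q0 im ny.
exists v'; split=> //.
have -> : psi (ev ((s, z, i) :: v, h)) =
    gc (~~ s) ^% z * (gx s ^% i ^ g^-1 * psi (ev (v, h))).
  by rewrite /ev /= !psiM !(morph_zexp psiM) psi_gct psi_s -conjg_zexp !mulgA.
rewrite nfC // /cact /= E /=.
have -> : (s == ~~ s) = false by case: (s).
by rewrite add0r.
Qed.

End Endomorphism.

(** Strip a power of x_(~s) from the left and a power of x_s from the right, until
    what remains is trivial, or starts with a power of x_s and ends with a power
    of c_(~s). *)
Lemma double_coset_form g : (exists r k, g = gx (~~ s) ^% r * gx s ^% k) \/
  exists r k i1 u q, [/\ reduced N ((s, 0%R, i1) :: u), q <> 0%R &
    g = gx (~~ s) ^% r * (evl ((s, 0%R, i1) :: u) * gc (~~ s) ^% q) * gx s ^% k].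
Proof.
have := nfK N_gt0 g; have := reduced_nf N_gt0 g.
case: (nf g) => u h /= ru; have os := reduced_on_side ru.
rewrite /ev (evtE N (~~ s)) negbK (zexp_gc _ s) /=.
set q := tail_exp _ _; set p := (_ * _)%R => eg.
case: u ru os eg => [|[[t z] i] u] ru os eg.
  by left; exists q, p; rewrite -eg mul1g gc_gx.
have {os} /andP[/eqP /= ts _] := os; subst t.
have [q0|/eqP q0] := eqVneq q 0%R; last first.
  right; exists z, p, i, u, q; split=> //.
  by rewrite -eg -gc_gx evl_cons0 !mulgA.
case/lastP: u ru eg => [|u [[t z'] i']] ru eg.
  left; exists z, (i + p)%R.
  by rewrite -eg q0 zexp0 /= mulg1 mul1g gc_gx zexpD !mulgA.
move: ru; rewrite -cats1 -cat_cons reduced_cat => /and3P[ru rl jo].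
have {rl} /andP[/eqP /= ts _] := reduced_on_side rl; subst t.
have lu : (last (s, z, i) u).1.1 == s.
  have := reduced_on_side ru => /=; rewrite eqxx /=.
  elim/last_ind: (u) => [|u1 l _]; first by rewrite eqxx.
  by rewrite last_rcons /on_side all_rcons => /andP[].
right; exists z, (i' + p)%R, i, u, z'; split=> //.
  by move: jo; rewrite /= (eqP lu) eqxx /= => /eqP.
rewrite -eg q0 zexp0 -cats1 -cat_cons evl_cat evl_cons0 mul1g.
by rewrite -[evl [:: _]]/(gc (~~ s) ^% z' * gx s ^% i' * 1) mulg1 -gc_gx zexpD !mulgA.
Qed.

(** Otherwise, composing psi with a conjugation replaces g by the middle factor in
    [double_coset_form]; then [nf_endomorphism] applies, and x_s, which has only
    one syllable, is not in the image. *)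
Lemma double_coset_of_surjective psi g : (1 < N s)%N -> {morph psi : x y / x * y} ->
  (forall y, exists x, psi x = y) -> psi (gx (~~ s)) = gx (~~ s) ->
  psi (gx s) = gx s ^ g^-1 -> exists r k, g = gx (~~ s) ^% r * gx s ^% k.
Proof.
move=> Ns_gt1 psiM surj psi_t psi_s.
have [//|[r [k [i [u [q [ru q0 eg]]]]]]] := double_coset_form g.
set a := gx (~~ s) ^% r in eg; set g' := _ * gc _ ^% q in eg.
pose psi' y := psi y ^ a.
have psi'M : {morph psi' : x y / x * y} by move=> x y; rewrite /psi' psiM conjMg.
have psi'_t : psi' (gx (~~ s)) = gx (~~ s).
  have C : commute (gx (~~ s)) a by apply: commute_zexp.
  by rewrite /psi' psi_t conjgE C mulKg.
have psi'_s : psi' (gx s) = gx s ^ g'^-1.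
  have C : commute (gx s) (gx s ^% (- k)%R) by apply: commute_zexp.
  rewrite /psi' psi_s -conjgM eg !invgM -!mulgA mulVg mulg1 -zexpN.
  by rewrite conjgM [gx s ^ _]conjgE C mulKg.
have [y0 y0s] := surj (gx s ^ a^-1).
have y0' : psi' y0 = gx s by rewrite /psi' y0s -conjgM mulVg conjg1.
have := nf_endomorphism psi'M psi'_t ru q0 psi'_s (nf y0).2 (reduced_nf N_gt0 y0).
rewrite -surjective_pairing nfK // y0' -[gx s]zexp1 nf_gx //=.
have -> : (1 %% N s)%Z = 1%R by rewrite modz_small //; apply/andP; split; lia.
rewrite /glue /=; case: (nf y0).1 => [|[[t z] j] v] //.
by case=> v' [v0 [_ _ e]]; case: v0.
Qed.

End OneExponent.

(** * Homomorphisms from the group *)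

Section Homomorphisms.
Variables (N : bool -> nat) (K : groupType).
Implicit Types (s t : bool).
Notation G := (Gmn (N true) (N false)).

Lemma gx_hom_ext (f h : G -> K) :
  {morph f : x y / x * y} -> {morph h : x y / x * y} ->
  (forall s, f (gx N s) = h (gx N s)) -> f =1 h.
Proof.
move=> fM hM fh; apply: presented_hom_ext => // c.
by have := fh (gen_side c); rewrite /gx gen_sideK.
Qed.

Variable a : bool -> K.

Definition Gmn_lift : G -> K := presented_lift (fun c => a (gen_side c)).

Hypothesis aC : commute (a true ^+ N true) (a false ^+ N false).

Let lift_relation l r : (l, r) \in Gmn_relations (N true) (N false) ->
  word_eval (fun c => a (gen_side c)) l = word_eval (fun c => a (gen_side c)) r.
Proof.
rewrite inE => /eqP[-> ->]; rewrite word_eval1 /commg /conjg !word_evalE /=.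
by apply/eqP; rewrite -[_ == _]/([~ _, _] == 1); apply/commgP.
Qed.

Lemma Gmn_liftM : {morph Gmn_lift : x y / x * y}.
Proof. exact: presented_liftM. Qed.

Lemma Gmn_lift_gx s : Gmn_lift (gx N s) = a s.
Proof. by rewrite /Gmn_lift presented_lift_gen // side_genK. Qed.

End Homomorphisms.

Lemma surjective_of_gx (N : bool -> nat) (K : groupType) (f : K -> Gmn (N true) (N false)) :
  {morph f : x y / x * y} -> (forall s, exists x, f x = gx N s) ->
  forall y, exists x, f x = y.
Proof.
move=> fM fx; apply: presented_ind => [|c y [z <-]|c y [z <-]].
- by exists 1; rewrite (morph1 fM).
- have [x xc] := fx (gen_side c); exists (x * z).
  by rewrite fM xc /gx gen_sideK.
- have [x xc] := fx (gen_side c); exists (x^-1 * z).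
  by rewrite fM (morphV fM) xc /gx gen_sideK.
Qed.

(** * Collapsing one exponent to 1 *)

(** Replacing N (~~ s) by 1 strengthens the relation: c_s commutes with x_(~s), and
    not only with its N (~~ s)-th power.  The resulting quotient map keeps the
    centraliser of c_s intact and sends that of c_(~s) to an abelian group. *)
Section Collapse.
Variables (N : bool -> nat) (s : bool).
Hypothesis N_gt0 : forall s, (0 < N s)%N.
Implicit Types (j k z i r : int) (u v : seq syllable) (w : state).
Notation G := (Gmn (N true) (N false)).

Definition collapsed (s' : bool) : nat := if s' == s then N s else 1%N.
Notation N' := collapsed.
Notation G' := (Gmn (N' true) (N' false)).

Lemma collapsed_gt0 s' : (0 < N' s')%N.
Proof. by rewrite /N'; case: eqP. Qed.

Lemma collapsed_self : N' s = N s.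
Proof. by rewrite /N' eqxx. Qed.

Lemma collapsed_other : N' (~~ s) = 1%N.
Proof. by rewrite /N'; case: (s). Qed.

Let N'_gt0 := collapsed_gt0.

Lemma gc_collapsed : gc N' s = gx N' s ^+ N s.
Proof. by rewrite /gc collapsed_self. Qed.

Lemma central_collapsed y : commute y (gc N' s).
Proof. exact: (gc_central N'_gt0 collapsed_other). Qed.

Let gx_commute (b : bool -> G') f : b (~~ s) = gx N' (~~ s) -> b s = gx N' s ^ f ->
  forall M : bool -> nat, M s = N s ->
  commute (b true ^+ M true) (b false ^+ M false).
Proof.
move=> bt bs M Ms; have C : commute (b (~~ s) ^+ M (~~ s)) (b s ^+ M s).
  by rewrite bs -conjXg Ms -gc_collapsed conjgE -central_collapsed mulKg; apply: central_collapsed.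
by move: C; case: (s) => //; apply: commute_sym.
Qed.

Definition collapse : G -> G' := Gmn_lift (gx N').

Let collapse_commute : commute (gx N' true ^+ N true) (gx N' false ^+ N false).
Proof. by apply: (@gx_commute (gx N') 1); rewrite ?conjg1. Qed.

Lemma collapseM : {morph collapse : x y / x * y}.
Proof. exact: Gmn_liftM. Qed.

Lemma collapse_gx s' : collapse (gx N s') = gx N' s'.
Proof. exact: Gmn_lift_gx. Qed.

Lemma collapse_gcs : collapse (gc N s) = gc N' s.
Proof. by rewrite (morphX collapseM) collapse_gx gc_collapsed. Qed.

Lemma collapse_gct k : collapse (gc N (~~ s) ^% k) = gc N' (~~ s) ^% (Posz (N (~~ s)) * k)%R.
Proof.
by rewrite /gc collapsed_other expg1 zexpM (morph_zexp collapseM) (morphX collapseM) collapse_gx.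
Qed.

Lemma collapse_other_side g : commute g (gc N (~~ s)) ->
  exists j k, collapse g = gx N' (~~ s) ^% j * gc N' s ^% k.
Proof.
pose Q y := exists j k, y = gx N' (~~ s) ^% j * gc N' s ^% k.
have QM y y' : Q y -> Q y' -> Q (y * y').
  move=> [j [k ->]] [j' [k' ->]]; exists (j + j')%R, (k + k')%R.
  rewrite !zexpD -!mulgA; congr (_ * _); rewrite !mulgA; congr (_ * _).
  by apply/commute_sym/commute_zexp/central_collapsed.
have Qt j : Q (gx N' (~~ s) ^% j) by exists j, 0%R; rewrite mulg1.
have Qs k : Q (gc N' s ^% k) by exists 0%R, k; rewrite mul1g.
have Qct k : Q (collapse (gc N (~~ s) ^% k)).
  by rewrite collapse_gct /gc collapsed_other expg1.
have Qcs k : Q (collapse (gc N s ^% k)).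
  by rewrite (morph_zexp collapseM) collapse_gcs.
move/(commute_gcP N_gt0) => o; rewrite -[g](nfK N_gt0) -/(Q _).
case: (nf N g) o => u h /=; rewrite /ev collapseM => ou; apply: (QM); last first.
  by rewrite (evtE N s) collapseM; apply: (QM).
elim: u ou => [|[[t z] i] u IHu] /=.
  by rewrite (morph1 collapseM); exists 0%R, 0%R; rewrite mulg1.
move=> /andP[/eqP-> /IHu Qu]; rewrite !collapseM negbK; apply: (QM) => //; apply: (QM) => //.
by rewrite (morph_zexp collapseM) collapse_gx.
Qed.

(** Effect of the collapse on syllables of side s: c_(~s) = x_(~s)^(N (~~ s)), and
    x_(~s) is itself the new c_(~s). *)
Definition scale (u : seq syllable) : seq syllable :=
  [seq (l.1.1, (Posz (N (~~ s)) * l.1.2)%R, l.2) | l <- u].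

Lemma reduced_scale u : on_side s u -> reduced N u -> reduced N' (scale u).
Proof.
elim: u => [|[[t z] i] u IHu] //= /andP[/eqP-> ou] /and4P[i0 iN nu ru].
rewrite collapsed_self i0 iN IHu // andbT /=.
case: u {IHu ru ou} nu => [|[[t' z'] i'] u] //=.
by have := N_gt0 (~~ s); case: eqP => //= _; nia.
Qed.

Lemma collapse_evl u : on_side s u -> collapse (evl N u) = evl N' (scale u).
Proof.
elim: u => [|[[t z] i] u IHu] /=; first by rewrite (morph1 collapseM).
move=> /andP[/eqP-> /IHu <-]; rewrite !collapseM collapse_gct.
by rewrite (morph_zexp collapseM) collapse_gx.
Qed.

(** The image of the normal form of g is again a normal form, so that it can be
    compared with the one of x_(~s)^r x_s^k, which has at most one syllable. *)
Lemma collapse_double_coset g : commute g (gc N s) ->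
  (exists r k, collapse g = gx N' (~~ s) ^% r * gx N' s ^% k) ->
  exists r k, g = gc N (~~ s) ^% r * gx N s ^% k.
Proof.
move=> C [r [k E]].
have ru := reduced_nf N_gt0 g; have := nfK N_gt0 g.
move/(commute_gcP N_gt0): C; case: (nf N g) ru => u h /= ru ou.
rewrite /ev (evtE N (~~ s)) negbK /=.
set q := tail_exp _ _; set p := tail_exp _ _ => eg.
have := congr1 (nf N') E.
rewrite -eg !collapseM collapse_evl // collapse_gct (morph_zexp collapseM) collapse_gcs.
rewrite -(gc_gx collapsed_other).
rewrite nfC // nf_gx // -[gc N' s ^% p]evt_single -evt_add.
rewrite -[X in nf N' X]/(ev N' (scale u, _)) evK ?reduced_scale // collapsed_self.
rewrite /glue /cact; case: eqP => /= [_|_].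
  case: u {ru ou} eg => //. move=> _ _; exists q, (Posz (N s) * p)%R.
  by rewrite /= mul1g (zexp_gc N s).
have -> : (s == ~~ s) = false by case: (s).
rewrite add0r /=; case: u {ru} ou eg => [|[[t z] i] [|l u]] //= /andP[/eqP /= ts _] eg.
subst t => -[_ _ /(congr1 (tail_exp (~~ s)))].
rewrite /tail_exp /tail_add => q0.
have {}q0 : q = 0%R by move: q0; have := N_gt0 (~~ s); case: (s) => /=; nia.
exists z, (i + Posz (N s) * p)%R.
by rewrite q0 zexp0 mul1g /= mulg1 zexpD -(zexp_gc N s) mulgA.
Qed.

(** Such a phi induces a surjective endomorphism of the collapsed group.  There
    g1 becomes a power of x_(~s) up to a central factor, and the conclusion
    about g1 g2 carries over to g2. *)
Lemma factor_of_surjective (phi : G -> G) g1 g2 :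
  (1 < N s)%N -> {morph phi : x y / x * y} -> (forall y, exists x, phi x = y) ->
  phi (gx N (~~ s)) = gx N (~~ s) -> phi (gx N s) = gx N s ^ (g1 * g2)^-1 ->
  commute g1 (gc N (~~ s)) -> commute g2 (gc N s) ->
  exists r k, g2 = gc N (~~ s) ^% r * gx N s ^% k.
Proof.
move=> Ns_gt1 phiM surj phi_t phi_s C1 C2; apply: collapse_double_coset => //.
pose b t := if t == s then gx N' s ^ (collapse (g1 * g2))^-1 else gx N' t.
have bs : b s = gx N' s ^ (collapse (g1 * g2))^-1 by rewrite /b eqxx.
have bt : b (~~ s) = gx N' (~~ s) by rewrite /b; case: (s).
have bC := gx_commute bt bs collapsed_self.
pose psi : G' -> G' := @Gmn_lift N' G' b.
have psi_collapse : psi \o collapse =1 collapse \o phi.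
  apply: gx_hom_ext => [x y|x y|t] /=.
  - by rewrite collapseM; apply: (Gmn_liftM bC).
  - by rewrite phiM collapseM.
  rewrite collapse_gx /psi (Gmn_lift_gx bC); have [->|/eqP ts] := eqVneq t s.
    by rewrite bs phi_s (morphJ collapseM) (morphV collapseM) collapse_gx.
  have -> : t = ~~ s by move: ts; case: (t); case: (s).
  by rewrite bt phi_t collapse_gx.
have surj_collapse : forall y, exists x, collapse x = y.
  by apply: surjective_of_gx collapseM _ => t; exists (gx N t); rewrite collapse_gx.
have surj_psi y : exists x, psi x = y.
  have [x <-] := surj_collapse y; have [z <-] := surj x.
  by exists (collapse z); rewrite -[LHS]/((psi \o collapse) z) psi_collapse.
have N's : (1 < N' s)%N by rewrite collapsed_self.
have [||r [k E]] := double_coset_of_surjective N'_gt0 collapsed_other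
  (g := collapse (g1 * g2)) N's (Gmn_liftM bC : {morph psi : x y / x * y}) surj_psi.
- by rewrite /psi (Gmn_lift_gx bC).
- by rewrite /psi (Gmn_lift_gx bC).
have [j [l E1]] := collapse_other_side C1.
exists (r - j)%R, (k - Posz (N s) * l)%R.
have -> : collapse g2 = (collapse g1)^-1 * collapse (g1 * g2).
  by rewrite collapseM mulKg.
have CZ y : commute y (gc N' s ^% (- l)%R) by apply/commute_zexp/central_collapsed.
rewrite E E1 invgM -!zexpN -mulgA -CZ mulgA -zexpD addrC -mulgA; congr (_ * _).
by rewrite zexpD (zexp_gc N' s) collapsed_self mulrN.
Qed.


End Collapse.

(** * Automorphisms *)

Lemma factor_of_1 (e i : int) : (e * i = 1)%R -> i = 1%R \/ i = (- 1)%R.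
Proof.
move=> ei; have := congr1 absz ei; rewrite abszM => /eqP.
by rewrite muln_eq1 => /andP[_ /eqP]; lia.
Qed.

Section Automorphisms.
Variable N : bool -> nat.
Hypothesis N_gt1 : forall s, (1 < N s)%N.
Implicit Types (s t : bool) (j k i r : int).
Notation G := (Gmn (N true) (N false)).
Notation gx := (gx N).
Notation gc := (gc N).
Implicit Types (g y z : G) (phi psi : aut G).

Let N_gt0 s : (0 < N s)%N. Proof. exact: ltnW (N_gt1 s). Qed.

Lemma aut_surj phi y : exists x, phi x = y.
Proof. by exists (phi^-1 y); exact: autVK. Qed.

Lemma aut_gx_ext phi psi : (forall s, phi (gx s) = psi (gx s)) -> phi = psi.
Proof. by move=> E; apply: autP; apply: gx_hom_ext => //; apply: aut_morph. Qed.

Lemma aut_zexp phi y k : phi (y ^% k) = phi y ^% k.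
Proof. exact: (morph_zexp (aut_morph phi)). Qed.

Lemma autJ phi y z : phi (y ^ z) = phi y ^ phi z.
Proof. exact: (morphJ (aut_morph phi)). Qed.

Lemma aut_gc phi s : phi (gc s) = phi (gx s) ^+ N s.
Proof. exact: (morphX (aut_morph phi)). Qed.

(** [factor_of_surjective] is applied to phi and to phi followed by conjugation by
    g^-1, which exchanges the roles of the two sides. *)
Lemma aut_fix_conj phi g : phi (gx true) = gx true -> phi (gx false) = gx false ^ g ->
  exists r k, g = gx false ^% r * gx true ^% k.
Proof.
move=> phi_t phi_f.
have C : commute (gc true) (gc (~~ true) ^ g).
  have := morph_commute (aut_morph phi) (commute_gc N true false).
  by rewrite !aut_gc phi_t phi_f conjXg.
have [g1 [g2 [eg C1 C2]]] := commute_conj_factor N_gt0 C.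
have [||||r2 [k2 e2]] := @factor_of_surjective N true N_gt0
   (fun y => phi y ^ (g1 * g2)^-1) g1 g2 (N_gt1 true) _ _ _ _ C1 C2.
- by move=> x y; rewrite aut_morph conjMg.
- move=> y; have [x xy] := aut_surj phi (y ^ (g1 * g2)); exists x.
  by rewrite xy -conjgM mulgV conjg1.
- by rewrite phi_f -conjgM eg mulgV conjg1.
- by rewrite phi_t.
have [|||r1 [k1 e1]] := @factor_of_surjective N false N_gt0
   phi g2^-1 g1^-1 (N_gt1 false) (aut_morph phi) (aut_surj phi) phi_t.
- by rewrite phi_f eg invgM !invgK.
- exact/commute_sym/commuteV/commute_sym.
- exact/commute_sym/commuteV/commute_sym.
exists (- k1 + Posz (N false) * r2)%R, (- (Posz (N true) * r1) + k2)%R.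
rewrite eg e2 -[g1]invgK e1 invgM -!zexpN !zexpD -!(zexp_gc N) -mulrN -(zexp_gc N).
rewrite -!mulgA; congr (_ * _); rewrite !mulgA; congr (_ * _).
exact/commute_zexp2/commute_gc.
Qed.

Lemma esum_hom (f : G -> G) s y : {morph f : x y / x * y} ->
  esum s (f y) = (esum true y * esum s (f (gx true)) + esum false y * esum s (f (gx false)))%R.
Proof.
move=> fM; elim/presented_ind: y => [|c y IHy|c y IHy].
- by rewrite (morph1 fM) !esum1 !mul0r addr0.
- have -> : pgen (Gmn_relations (N true) (N false)) c = gx (gen_side c).
    by rewrite /gx gen_sideK.
  by rewrite fM !esumM IHy !esum_gx; case: (gen_side c) => /=; lia.
- have -> : pgen (Gmn_relations (N true) (N false)) c = gx (gen_side c).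
    by rewrite /gx gen_sideK.
  by rewrite fM (morphV fM) !esumM !esumV IHy !esum_gx; case: (gen_side c) => /=; lia.
Qed.

(** The image of c_(~s) commutes with the N s-th power of the image of x_s, but not
    with the image of x_s itself. *)
Lemma aut_gx_conj phi s :
  exists t j y, phi (gx s) = (gx t ^% j) ^ y /\ ((j * Posz (N s))%R %% N t)%Z = 0%R.
Proof.
have C : commute (phi (gc (~~ s))) (phi (gx s) ^+ N s).
  by rewrite -aut_gc; apply: (morph_commute (aut_morph phi)); apply: commute_gc.
have [C'|//] := commute_power_cases N_gt0 (N_gt0 s) C.
have {}C' : commute (gc (~~ s)) (gx s).
  by apply: (bij_inj (aut_bij phi)); rewrite !aut_morph.
have [|j e] := @commute_gx N N_gt0 s 1%R _ _ C'.
  by have := N_gt1 s => ?; rewrite modz_small //; apply/andP; split; lia.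
have := congr1 (esum (~~ s)) e; rewrite esum_zexp esum_gc esum_gx eqxx.
have -> : (s == ~~ s) = false by case: (s).
by have := N_gt0 (~~ s); lia.
Qed.

(** On the abelianisation phi acts by an invertible matrix, which by
    [aut_gx_conj] has a single nonzero entry in each row; so the entries are 1
    or -1, in diagonal or antidiagonal position. *)
Lemma aut_gx_cases phi : exists t i j y z,
  [/\ phi (gx true) = (gx t ^% i) ^ y, phi (gx false) = (gx (~~ t) ^% j) ^ z,
      i = 1%R \/ i = (- 1)%R, j = 1%R \/ j = (- 1)%R & t \/ N true = N false].
Proof.
have [t [i [y [et it]]]] := aut_gx_conj phi true.
have [t' [j [z [ef jt]]]] := aut_gx_conj phi false.
have E s w := esum_hom s w (aut_morph phi).
have tt' : t' = ~~ t.
  have [w ew] := aut_surj phi (gx (~~ t)).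
  have := E (~~ t) w; rewrite ew et ef !esumJ !esum_zexp !esum_gx eqxx.
  by case: (t) (t') => [] [] /=; lia.
subst t'.
have i1 : i = 1%R \/ i = (- 1)%R.
  have [w ew] := aut_surj phi (gx t).
  have := E t w; rewrite ew et ef !esumJ !esum_zexp !esum_gx eqxx.
  by move=> H; apply: (@factor_of_1 (esum true w)); move: H; case: (t) => /=; lia.
have j1 : j = 1%R \/ j = (- 1)%R.
  have [w ew] := aut_surj phi (gx (~~ t)).
  have := E (~~ t) w; rewrite ew et ef !esumJ !esum_zexp !esum_gx eqxx.
  by move=> H; apply: (@factor_of_1 (esum false w)); move: H; case: (t) => /=; lia.
exists t, i, j, y, z; split=> //.
case: t it jt {et ef} => /= it jt; [by left | right].
have le_dvd (p q : nat) (e : int) : (0 < p)%N -> e = 1%R \/ e = (- 1)%R ->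
    ((e * Posz p)%R %% q)%Z = 0%R -> (q <= p)%N.
  move=> p0 e1 /dvdz_mod0P; rewrite dvdzE abszM => /dvdn_leq.
  by case: e1 => ->; rewrite mul1n; apply.
by have := le_dvd _ _ _ (N_gt0 true) i1 it; have := le_dvd _ _ _ (N_gt0 false) j1 jt; lia.
Qed.

Lemma involution_exists (b : bool -> G) :
  commute (b true ^+ N true) (b false ^+ N false) ->
  (forall s, @Gmn_lift N G b (b s) = gx s) ->
  exists phi : aut G, forall s, phi (gx s) = b s.
Proof.
move=> bC bb; have bM := Gmn_liftM bC.
have bK : involutive (@Gmn_lift N G b).
  by apply: gx_hom_ext => // [x y|s]; rewrite ?bM // (Gmn_lift_gx bC) bb.
by exists (Aut (inv_bij bK) bM) => s; rewrite -(Gmn_lift_gx bC).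
Qed.

(** S plays the role of the subgroup generated by the given automorphisms. *)
Section Generation.
Variables (lambda mu : aut G).
Hypothesis lambdaE : forall s, lambda (gx s) = if s then (gx s)^-1 else gx s.
Hypothesis muE : forall s, mu (gx s) = if s then gx s else (gx s)^-1.
Variable S : aut G -> Prop.
Hypothesis SM : forall phi psi, S phi -> S psi -> S (phi * psi).
Hypothesis SV : forall phi, S phi -> S phi^-1.
Hypotheses (Slambda : S lambda) (Smu : S mu) (Sinner : forall s, S (inner (gx s))).

Lemma all_inner y : S (inner y).
Proof.
have S1 : S 1 by rewrite -(mulgV lambda); apply: SM => //; apply: SV.
elim/presented_ind: y => [|c y IHy|c y IHy].
- by rewrite inner1.
- by rewrite innerM; apply: SM => //; have := Sinner (gen_side c); rewrite /gx gen_sideK.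
- rewrite innerM innerV; apply: SM => //; apply: SV.
  by have := Sinner (gen_side c); rewrite /gx gen_sideK.
Qed.

Lemma S_mulr phi psi : S psi -> S (phi * psi) -> S phi.
Proof. by move=> Sp Spp; rewrite -[phi](mulgK psi); apply: SM => //; apply: SV. Qed.

Lemma straight_generated phi i j y z :
  phi (gx true) = (gx true ^% i) ^ y -> phi (gx false) = (gx false ^% j) ^ z ->
  i = 1%R \/ i = (- 1)%R -> j = 1%R \/ j = (- 1)%R -> S phi.
Proof.
move=> phi_t phi_f i1 j1.
apply: (S_mulr (all_inner y^-1)); set phi1 := _ * _.
have phi1_t : phi1 (gx true) = gx true ^% i.
  by rewrite aut_mulE innerE phi_t -conjgM mulgV conjg1.
have [z1 phi1_f] : exists z1, phi1 (gx false) = (gx false ^% j) ^ z1.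
  by exists (z * y^-1); rewrite aut_mulE innerE phi_f -conjgM.
clearbody phi1.
have [psi1 [S1 [p1_t p1_f]]] : exists psi1, S psi1 /\
    ((phi1 * psi1) (gx true) = gx true /\
     exists z2, (phi1 * psi1) (gx false) = (gx false ^% j) ^ z2).
  case: i1 phi1_t => -> phi1_t.
    exists (inner 1); split; first exact: all_inner.
    by rewrite !aut_mulE !innerE !conjg1 phi1_t; split=> //; exists z1.
  exists lambda; split=> //; rewrite !aut_mulE phi1_t phi1_f aut_zexp lambdaE.
  rewrite zexpN zexp1 invgK; split=> //.
  by exists (lambda z1); rewrite autJ aut_zexp lambdaE.
apply: (S_mulr S1); set phi2 := phi1 * psi1 in p1_t p1_f *; case: p1_f => z2 p2_f.
clearbody phi2.
have [psi2 [S2 [p2_t [z3 p3_f]]]] : exists psi2, S psi2 /\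
    ((phi2 * psi2) (gx true) = gx true /\ exists z3, (phi2 * psi2) (gx false) = gx false ^ z3).
  case: j1 p2_f => -> p2_f.
    exists (inner 1); split; first exact: all_inner.
    by rewrite !aut_mulE !innerE !conjg1 p1_t; split=> //; exists z2.
  exists mu; split=> //; rewrite !aut_mulE p1_t p2_f muE; split=> //.
  by exists (mu z2); rewrite autJ aut_zexp muE zexpN zexp1 invgK.
apply: (S_mulr S2); have [r [k ez]] := aut_fix_conj p2_t p3_f.
suff -> : phi2 * psi2 = inner (gx true ^% k) by apply: all_inner.
have Cx s l : gx s ^ (gx s ^% l) = gx s.
  have C : commute (gx s) (gx s ^% l) by apply: commute_zexp.
  by rewrite conjgE C mulKg.
by apply: aut_gx_ext => -[]; rewrite innerE ?p2_t ?p3_f ?Cx // ez conjgM Cx.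
Qed.

Lemma aut_generated : (N true = N false -> exists eta, S eta /\ forall s, eta (gx s) = gx (~~ s)) ->
  forall phi, S phi.
Proof.
move=> He phi; have [t [i [j [y [z [et ef i1 j1 tN]]]]]] := aut_gx_cases phi.
case: t et ef tN => et ef tN; first exact: straight_generated et ef i1 j1.
case: tN => // /He [eta [Se etaE]]; apply: (S_mulr Se).
apply: (@straight_generated _ i j (eta y) (eta z)) => //.
  by rewrite aut_mulE et autJ aut_zexp etaE.
by rewrite aut_mulE ef autJ aut_zexp etaE.
Qed.

End Generation.

End Automorphisms.

(** * Presentations *)

Section Satisfies.
Variables (K : groupType) (X : Type) (f : X -> K).

Definition satisfies (R : seq (word X * word X)) :=
  forall l r, (l, r) \in R -> word_eval f l = word_eval f r.

Lemma satisfies_cons l r R :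
  satisfies ((l, r) :: R) <-> word_eval f l = word_eval f r /\ satisfies R.
Proof.
split=> [H|[H HR] l' r']; last by rewrite inE => /orP[/eqP[-> ->]|/HR].
split=> [|l' r' R']; apply: H; first exact: mem_head.
by rewrite inE R' orbT.
Qed.

Definition common_equations m n (l u a b : K) : Prop :=
  (l ^+ 2 = 1 /\ u ^+ 2 = 1 /\ l * u = u * l) /\
  (l^-1 * a * l = a^-1 /\ l^-1 * b * l = b /\
   u^-1 * a * u = a /\ u^-1 * b * u = b^-1) /\
  a ^+ m * b ^+ n = b ^+ n * a ^+ m.

Lemma satisfies_common m n l u a b R :
  satisfies (common_relations m n (letter l) (letter u) (letter a) (letter b) ++ R) <->
  common_equations m n (f l) (f u) (f a) (f b) /\ satisfies R.
Proof.
rewrite /common_relations /= !satisfies_cons !word_evalE /common_equations.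
by tauto.
Qed.

End Satisfies.

Lemma satisfies_pgen X (R : seq (word X * word X)) : satisfies (@pgen X R) R.
Proof.
by move=> l r lr; rewrite !word_eval_pgen; apply/word_class_eqP/csq_rel.
Qed.

(** A criterion for relations to define a group of automorphisms containing the
    inner ones: theta lifts the inner automorphisms to the presented group, and T
    is a set of representatives of its elements modulo the image of theta. *)
Section InnerExtension.
Variables (G : groupType) (X : Type) (g : X -> aut G) (R : seq (word X * word X)).
Variables (theta : G -> presented R) (T : presented R -> Prop).
Hypothesis gR : satisfies g R.
Hypothesis thetaM : {morph theta : x y / x * y}.
Hypothesis theta_inner : forall y, presented_lift g (theta y) = inner y.
Hypothesis T1 : T 1.
Hypothesis T_gen : forall c, (forall t, T t -> T (pgen R c * t) /\ T ((pgen R c)^-1 * t)) \/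
  exists x, pgen R c = theta x.
Hypothesis T_norm : forall t y, T t -> exists y', theta y ^ t = theta y'.
Hypothesis T_faithful : forall t y, T t -> presented_lift g t * inner y = 1 -> t = 1 /\ y = 1.

Lemma inner_extension_normal_form x : exists t y, T t /\ x = t * theta y.
Proof.
elim/presented_ind: x => [|c x [t [y [Tt ->]]]|c x [t [y [Tt ->]]]].
- by exists 1, 1; rewrite (morph1 thetaM) mulg1.
- have [Tc|[z ->]] := T_gen c.
    by exists (pgen R c * t), y; rewrite mulgA; have [] := Tc t Tt.
  have [z' zt] := T_norm z Tt; exists t, (z' * y); split=> //.
  by rewrite thetaM -zt conjgE !mulgA mulgV mul1g.
- have [Tc|[z ->]] := T_gen c.
    by exists ((pgen R c)^-1 * t), y; rewrite mulgA; have [] := Tc t Tt.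
  have [z' zt] := T_norm z^-1 Tt; exists t, (z' * y); split=> //.
  by rewrite thetaM -zt (morphV thetaM) conjgE !mulgA mulgV mul1g.
Qed.

Lemma inner_extension_defined_by : defined_by g R.
Proof.
move=> u v; split=> [uv|]; last exact: word_eval_csq.
apply/word_class_eqP; apply: divg1_eq.
have [t [y [Tt E]]] := inner_extension_normal_form (word_class R u / word_class R v).
rewrite E; have [|-> ->] := T_faithful (y := y) Tt; last by rewrite (morph1 thetaM) mulg1.
rewrite -theta_inner -(presented_liftM gR) -E -word_classV -word_classM presented_lift_class //.
by rewrite !word_evalE uv mulgV.
Qed.

End InnerExtension.

Section GeneratedSet.
Variables (K : groupType) (X : Type) (f : X -> K).

Definition generated x := exists w, word_eval f w = x.

Lemma generatedM x y : generated x -> generated y -> generated (x * y).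
Proof. by move=> [p <-] [q <-]; exists (p * q); rewrite word_evalM. Qed.

Lemma generatedV x : generated x -> generated x^-1.
Proof. by move=> [p <-]; exists p^-1; rewrite word_evalV. Qed.

Lemma generated_gen c : generated (f c).
Proof. by exists (letter c); rewrite word_eval_letter. Qed.

End GeneratedSet.

Section Involutions.
Variable K : groupType.
Implicit Types l u h : K.

Lemma mul_bool_exp l (e : bool) : l ^+ 2 = 1 -> l * l ^+ e = l ^+ (~~ e).
Proof. by case: e; rewrite ?mulg1. Qed.

Lemma invg_involution l : l ^+ 2 = 1 -> l^-1 = l.
Proof. by move=> l2; apply: mulg1_eq. Qed.

Lemma commute_bool_exp l u (e f : bool) : l * u = u * l -> commute (l ^+ e) (u ^+ f).
Proof. exact: commuteX2. Qed.

Lemma swap_bool_exp l u h (e : bool) : h ^+ 2 = 1 -> h^-1 * l * h = u ->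
  h * l ^+ e = u ^+ e * h.
Proof.
move=> h2 <-; case: e; rewrite ?mulg1 ?mul1g //.
by rewrite !expg1 -{1}[h](invg_involution h2) -!mulgA -[h * h]/(h ^+ 2) h2 mulg1.
Qed.

End Involutions.

Section Outer.
Variables (m n : nat).
Hypotheses (m_gt1 : (1 < m)%N) (n_gt1 : (1 < n)%N).
Let N (s : bool) := if s then m else n.
Notation G := (Gmn m n).
Notation gx := (gx N).

Let N_gt1 s : (1 < N s)%N. Proof. by case: s. Qed.
Let N_gt0 s : (0 < N s)%N. Proof. exact: ltnW (N_gt1 s). Qed.

Let lift (K : groupType) (b : bool -> K) : G -> K := @Gmn_lift N K b.

Let gx_relation : commute (gx true ^+ m) (gx false ^+ n).
Proof. exact: (commute_gc N true false). Qed.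

Lemma lambda_exists : exists lambda : aut G,
  forall s, lambda (gx s) = if s then (gx s)^-1 else gx s.
Proof.
have bC : commute ((gx true)^-1 ^+ m) (gx false ^+ n).
  by rewrite expVgn; apply/commute_sym/commuteV/commute_sym.
apply: (@involution_exists N (fun s => if s then (gx s)^-1 else gx s)) => // s.
pose b s := if s then (gx s)^-1 else gx s.
have bM : {morph lift b : x y / x * y} by apply: (@Gmn_liftM N _ b).
have bx t : lift b (gx t) = b t by apply: (@Gmn_lift_gx N _ b).
by rewrite -/(lift b); case: s; rewrite ?(morphV bM) bx /b /= ?invgK.
Qed.

Lemma mu_exists : exists mu : aut G,
  forall s, mu (gx s) = if s then gx s else (gx s)^-1.
Proof.
have bC : commute (gx true ^+ m) ((gx false)^-1 ^+ n).
  by rewrite expVgn; apply/commuteV.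
apply: (@involution_exists N (fun s => if s then gx s else (gx s)^-1)) => // s.
pose b s := if s then gx s else (gx s)^-1.
have bM : {morph lift b : x y / x * y} by apply: (@Gmn_liftM N _ b).
have bx t : lift b (gx t) = b t by apply: (@Gmn_lift_gx N _ b).
by rewrite -/(lift b); case: s; rewrite ?(morphV bM) bx /b /= ?invgK.
Qed.

Lemma eta_exists : m = n -> exists eta : aut G, forall s, eta (gx s) = gx (~~ s).
Proof.
move=> mn; have bC : commute (gx false ^+ m) (gx true ^+ n).
  rewrite (_ : gx false ^+ m = gx false ^+ n); last by congr (_ ^+ _).
  rewrite (_ : gx true ^+ n = gx true ^+ m); last by congr (_ ^+ _).
  exact: commute_sym.
apply: (@involution_exists N (fun s => gx (~~ s))) => // s.
by rewrite (@Gmn_lift_gx N _ (fun s => gx (~~ s))) // negbK.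
Qed.

Section ThetaMap.
Variables (K : groupType) (l u a b : K).
Hypothesis eqK : common_equations m n l u a b.
Variables (lambda mu : aut G).
Hypothesis lambdaE : forall s, lambda (gx s) = if s then (gx s)^-1 else gx s.
Hypothesis muE : forall s, mu (gx s) = if s then gx s else (gx s)^-1.

Definition theta : G -> K := lift (fun s => if s then a else b).

Lemma thetaM : {morph theta : x y / x * y}.
Proof. by apply: (@Gmn_liftM N _ (fun s => if s then a else b)); case: eqK => _ []. Qed.

Lemma theta_gx s : theta (gx s) = if s then a else b.
Proof. by apply: (@Gmn_lift_gx N _ (fun s => if s then a else b)); case: eqK => _ []. Qed.

Lemma theta_conj (phi : aut G) k :
  (forall s, theta (gx s) ^ k = theta (phi (gx s))) -> forall y, theta y ^ k = theta (phi y).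
Proof.
apply: (@gx_hom_ext N K (fun y => theta y ^ k) (theta \o phi)) => x y /=.
  by rewrite thetaM conjMg.
by rewrite aut_morph thetaM.
Qed.

Lemma theta_l y : theta y ^ l = theta (lambda y).
Proof.
case: eqK => _ [[la [lb _]] _]; move: y; apply: theta_conj => s.
by rewrite lambdaE; case: s; rewrite ?(morphV thetaM) theta_gx conjgE mulgA.
Qed.

Lemma theta_u y : theta y ^ u = theta (mu y).
Proof.
case: eqK => _ [[_ [_ [ua ub]]] _]; move: y; apply: theta_conj => s.
by rewrite muE; case: s; rewrite ?(morphV thetaM) theta_gx conjgE mulgA.
Qed.

Lemma theta_norm_bool k (phi : aut G) (e : bool) :
  (forall y, theta y ^ k = theta (phi y)) ->
  forall y, exists y', theta y ^ (k ^+ e) = theta y'.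
Proof.
by move=> H y; case: e; [exists (phi y) | exists y]; rewrite ?expg1 ?H // conjg1.
Qed.

End ThetaMap.

Section OuterAut.
Variables (lambda mu : aut G).
Hypothesis lambdaE : forall s, lambda (gx s) = if s then (gx s)^-1 else gx s.
Hypothesis muE : forall s, mu (gx s) = if s then gx s else (gx s)^-1.

Lemma common_equations_aut :
  common_equations m n lambda mu (inner (gx true)) (inner (gx false)).
Proof.
have ext (phi psi : aut G) : (forall s, phi (gx s) = psi (gx s)) -> phi = psi.
  exact: (@aut_gx_ext N phi psi).
have E (phi : aut G) (x : G) : phi^-1 * inner x * phi = inner (phi x).
  by rewrite -mulgA -innerJ.
have lV x : lambda x^-1 = (lambda x)^-1 by exact: (morphV (aut_morph lambda)).
have uV x : mu x^-1 = (mu x)^-1 by exact: (morphV (aut_morph mu)).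
split; [split; [|split]|split; [split; [|split; [|split]]|]].
- by apply: ext => s; rewrite expg2 aut_mulE lambdaE; case: s; rewrite ?lV lambdaE ?invgK.
- by apply: ext => s; rewrite expg2 aut_mulE muE; case: s; rewrite ?uV muE ?invgK.
- by apply: ext => s; rewrite !aut_mulE lambdaE muE; case: s; rewrite ?uV ?lV lambdaE muE.
- by rewrite E lambdaE innerV.
- by rewrite E lambdaE.
- by rewrite E muE.
- by rewrite E muE innerV.
- have iM : {morph @inner G : x y / x * y} by exact: innerM.
  by rewrite -!(morphX iM) -!innerM gx_relation.
Qed.

(** Inner automorphisms preserve exponent sums. *)
Lemma esum_of_inner (phi : aut G) y s t : phi * inner y = 1 ->
  @esum N t (phi (gx s)) = if s == t then 1%R else 0%R.
Proof.
move=> E; have /(congr1 (@esum N t)) : (phi * inner y) (gx s) = gx s by rewrite E.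
by rewrite aut_mulE innerE esumJ esum_gx.
Qed.

Lemma inner_eq1 (y : G) : inner y = 1 -> y = 1.
Proof.
move=> E; apply: (@center_trivial N N_gt0) => // x.
have : inner y x = x by rewrite E.
by rewrite innerE => H; apply/commute_sym; rewrite /commute conjgC H.
Qed.

Notation alpha := (inner (gx true)).
Notation beta := (inner (gx false)).

Let lambdaX (e : bool) s : (lambda ^+ e) (gx s) = gx s ^% (if e && s then -1 else 1)%R.
Proof. by case: e => //=; rewrite expg1 lambdaE; case: s. Qed.

Let muX (e : bool) s : (mu ^+ e) (gx s) = gx s ^% (if e && ~~ s then -1 else 1)%R.
Proof. by case: e => //=; rewrite expg1 muE; case: s. Qed.

Lemma esum_outer (e f : bool) s t :
  @esum N t ((lambda ^+ e * mu ^+ f) (gx s)) =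
  (if s == t then if (if s then e else f) then -1 else 1 else 0)%R.
Proof.
rewrite aut_mulE lambdaX (aut_zexp (N := N)) muX !esum_zexp esum_gx.
by case: s; case: t; case: e; case: f.
Qed.

(** The representatives are the products lambda^e mu^f with e, f in {0, 1}: the
    relations make them closed under left multiplication by lambda and mu. *)
Lemma presented4 : m <> n ->
  presented_by (family4 lambda mu alpha beta) (relations4 m n).
Proof.
move=> mn; set g := family4 _ _ _ _; split.
  apply: (aut_generated N_gt1 lambdaE muE (@generatedM _ _ g) (@generatedV _ _ g)) => //.
  - exact: (generated_gen g Lambda4).
  - exact: (generated_gen g Mu4).
  - by case; [exact: (generated_gen g Alpha4) | exact: (generated_gen g Beta4)].
rewrite -[relations4 m n]cats0; set R := _ ++ _.
have gR : satisfies g R by apply/satisfies_common; split=> //; apply: common_equations_aut.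
have [eqR _] := (satisfies_common (pgen R) m n Lambda4 Mu4 Alpha4 Beta4 [::]).1
  (@satisfies_pgen _ R).
have [[l2 [u2 lu]] _] := eqR; set l := pgen R Lambda4 in l2 lu; set u := pgen R Mu4 in u2 lu.
pose T x := exists e f : bool, x = l ^+ e * u ^+ f.
have Tl t : T t -> T (l * t).
  by move=> [e [f ->]]; exists (~~ e), f; rewrite mulgA mul_bool_exp.
have Tu t : T t -> T (u * t).
  move=> [e [f ->]]; exists e, (~~ f).
  by rewrite mulgA -(commute_bool_exp e true lu) expg1 -mulgA mul_bool_exp.
apply: (@inner_extension_defined_by G _ g R (theta (pgen R Alpha4) (pgen R Beta4)) T) => //.
- exact: (thetaM eqR).
- apply: (@gx_hom_ext N _ (presented_lift g \o theta _ _)) => [x y|x y|s] /=.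
  + by rewrite (thetaM eqR) (presented_liftM gR).
  + exact: innerM.
  + by rewrite (theta_gx eqR); case: s; rewrite (presented_lift_gen gR).
- by exists false, false; rewrite mulg1.
- case; [left|left|right|right].
  + by move=> t Tt; rewrite (invg_involution l2); split; apply: Tl.
  + by move=> t Tt; rewrite (invg_involution u2); split; apply: Tu.
  + by exists (gx true); rewrite (theta_gx eqR).
  + by exists (gx false); rewrite (theta_gx eqR).
- move=> _ y [e [f ->]].
  have [y1 E1] := theta_norm_bool e (theta_l eqR lambdaE) y.
  have [y2 E2] := theta_norm_bool f (theta_u eqR muE) y1.
  by exists y2; rewrite conjgM E1 E2.
- move=> _ y [e [f ->]].
  rewrite (presented_liftM gR) !(morphX (presented_liftM gR)) !(presented_lift_gen gR) /= => E.
  have := esum_of_inner true true E; have := esum_of_inner false false E.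
  rewrite !esum_outer /=; case: e f E => [] [] // E _ _.
  by split; [exact: mulg1 | apply: inner_eq1; move: (E : 1 * 1 * inner y = 1); rewrite !mul1g].
Qed.

(** The representatives are now the products lambda^e mu^f eta^k, an image of the
    dihedral group of order 8; those with k = 1 exchange the two exponent sums. *)
Lemma presented5 (eta : aut G) : (forall s, eta (gx s) = gx (~~ s)) -> m = n ->
  presented_by (family5 lambda mu eta alpha beta) (relations5 m n).
Proof.
move=> etaE mn; set g := family5 _ _ _ _ _; split.
  apply: (aut_generated N_gt1 lambdaE muE (@generatedM _ _ g) (@generatedV _ _ g)) => //.
  - exact: (generated_gen g Lambda5).
  - exact: (generated_gen g Mu5).
  - by case; [exact: (generated_gen g Alpha5) | exact: (generated_gen g Beta5)].
  - by exists eta; split=> //; exact: (generated_gen g Eta5).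
set R := relations5 m n.
have eta2 : eta ^+ 2 = 1.
  by apply: (@aut_gx_ext N) => s; rewrite expg2 aut_mulE !etaE negbK.
have etaV x : eta x^-1 = (eta x)^-1 by exact: (morphV (aut_morph eta)).
have gR : satisfies g R.
  apply/satisfies_common; split; first exact: common_equations_aut.
  rewrite !satisfies_cons !word_evalE /=; split=> //; split; last split=> //.
    apply: (@aut_gx_ext N) => s; rewrite (invg_involution eta2) !aut_mulE etaE lambdaE muE.
    by case: s; rewrite ?etaV etaE.
  by rewrite -mulgA -[LHS]/(alpha ^ eta) innerJ etaE.
have [eqR] := (satisfies_common (pgen R) m n Lambda5 Mu5 Alpha5 Beta5 _).1 (@satisfies_pgen _ R).
rewrite !satisfies_cons !word_evalE => -[h2 [hl [ha _]]].
have [[l2 [u2 lu]] _] := eqR; set l := pgen R Lambda5 in l2 lu hl; set u := pgen R Mu5 in u2 lu hl.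
set h := pgen R Eta5 in h2 hl ha.
have hu : h^-1 * u * h = l.
  by rewrite -hl (invg_involution h2) -!mulgA -expg2 h2 mulg1 !mulgA -expg2 h2 mul1g.
have hb : h^-1 * pgen R Beta5 * h = pgen R Alpha5.
  by rewrite -ha (invg_involution h2) -!mulgA -expg2 h2 mulg1 !mulgA -expg2 h2 mul1g.
pose T x := exists e f k : bool, x = l ^+ e * u ^+ f * h ^+ k.
have Tl t : T t -> T (l * t).
  by move=> [e [f [k ->]]]; exists (~~ e), f, k; rewrite !mulgA mul_bool_exp.
have Tu t : T t -> T (u * t).
  move=> [e [f [k ->]]]; exists e, (~~ f), k.
  by rewrite !mulgA -(commute_bool_exp e true lu) expg1 -[_ * u * _]mulgA mul_bool_exp.
have Th t : T t -> T (h * t).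
  move=> [e [f [k ->]]]; exists f, e, (~~ k).
  rewrite !mulgA (swap_bool_exp _ h2 hl) -[_ * h * _]mulgA (swap_bool_exp _ h2 hu).
  by rewrite mulgA -[_ * h * _]mulgA mul_bool_exp // (commute_bool_exp f e lu).
apply: (@inner_extension_defined_by G _ g R (theta (pgen R Alpha5) (pgen R Beta5)) T) => //.
- exact: (thetaM eqR).
- apply: (@gx_hom_ext N _ (presented_lift g \o theta _ _)) => [x y|x y|s] /=.
  + by rewrite (thetaM eqR) (presented_liftM gR).
  + exact: innerM.
  + by rewrite (theta_gx eqR); case: s; rewrite (presented_lift_gen gR).
- by exists false, false, false; rewrite !mulg1.
- case; [left|left|left|right|right].
  + by move=> t Tt; rewrite (invg_involution l2); split; apply: Tl.
  + by move=> t Tt; rewrite (invg_involution u2); split; apply: Tu.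
  + by move=> t Tt; rewrite (invg_involution h2); split; apply: Th.
  + by exists (gx true); rewrite (theta_gx eqR).
  + by exists (gx false); rewrite (theta_gx eqR).
- move=> _ y [e [f [k ->]]].
  have [y1 E1] := theta_norm_bool e (theta_l eqR lambdaE) y.
  have [y2 E2] := theta_norm_bool f (theta_u eqR muE) y1.
  have theta_h : forall y, theta (pgen R Alpha5) (pgen R Beta5) y ^ h =
      theta (pgen R Alpha5) (pgen R Beta5) (eta y).
    apply: (theta_conj eqR) => s; rewrite etaE !(theta_gx eqR) conjgE mulgA.
    by case: s.
  have [y3 E3] := theta_norm_bool k theta_h y2.
  by exists y3; rewrite !conjgM E1 E2 E3.
- move=> _ y [e [f [k ->]]].
  rewrite !(presented_liftM gR) !(morphX (presented_liftM gR)) !(presented_lift_gen gR) /= => E.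
  have X s : exists j, (lambda ^+ e * mu ^+ f) (gx s) = gx s ^% j.
    by rewrite aut_mulE lambdaX (aut_zexp (N := N)) muX -zexpM; eexists.
  case: k E => [|E]; last first.
    rewrite mulg1 in E *; have := esum_of_inner true true E; have := esum_of_inner false false E.
    rewrite !esum_outer /=; case: e f E {X} => [] [] // E _ _.
    split; first by rewrite !mulg1.
    by apply: inner_eq1; move: (E : 1 * 1 * inner y = 1); rewrite !mul1g.
  rewrite expg1 => E; have := esum_of_inner true true E.
  have [j Xj] := X true; rewrite aut_mulE Xj (aut_zexp (N := N)) etaE.
  by rewrite esum_zexp esum_gx mul0r.
Qed.

End OuterAut.

End Outer.

Theorem theorem1 (m n : nat) (m_gt1 : (1 < m)%N) (n_gt1 : (1 < n)%N) :
  let a := Gmn_a m n in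
  let b := Gmn_b m n in
  let alpha := inner a in
  let beta := inner b in
  exists lambda mu : aut (Gmn m n),
    [/\ lambda a = a^-1, lambda b = b, mu a = a & mu b = b^-1] /\
    (m <> n ->
       presented_by (family4 lambda mu alpha beta) (relations4 m n)) /\
    (m = n ->
       exists eta : aut (Gmn m n),
         [/\ eta a = b, eta b = a &
             presented_by (family5 lambda mu eta alpha beta) (relations5 m n)]).
Proof.
move=> a b alpha beta.
have [lambda lambdaE] := lambda_exists m n.
have [mu muE] := mu_exists m n.
exists lambda, mu; split.
  split; [exact: (lambdaE true) | exact: (lambdaE false) |
    exact: (muE true) | exact: (muE false)].
split=> [|mn]; first exact: presented4.
have [eta etaE] := eta_exists mn; exists eta.
by split; [exact: (etaE true) | exact: (etaE false) | exact: presented5].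
Qed.
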